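(* Let $\Sigma=\{(x,u(x)) : x\in\mathbb{R}^n\}\subseteq\mathbb{R}^{n+1}$, with $u:\mathbb{R}^n\to\mathbb{R}$ smooth, be an entire graphical translator with velocity $T$, where $T\in\mathbb{R}^{n+1}$ is a unit vector not parallel to $e_{n+1}$. If the gradient of $u$ satisfies the growth rate $$|Du(x)|=o(|x|^{1/4})\qquad\text{as } |x|\to\infty,$$ then $\Sigma$ is a hyperplane.
   Context: $e_1,\dots,e_{n+1}$ is the standard basis of $\mathbb{R}^{n+1}$. The graph $\Sigma$ of a smooth function $u:\mathbb{R}^n\to\mathbb{R}$ is an entire graphical translator with velocity (direction) $T$ if $H=\langle\nu,T\rangle$ on $\Sigma$, where $\nu=\frac{(-Du,1)}{\sqrt{1+|Du|^2}}$ is the upward unit normal and $H=\sum_{i=1}^n D_i\left(\frac{D_iu}{\sqrt{1+|Du|^2}}\right)$ is the mean curvature. Writing $T=(T',T_{n+1})$ with $T'\in\mathbb{R}^n$, this is the equation $\sum_{i=1}^n D_i\left(\frac{D_iu}{\sqrt{1+|Du|^2}}\right)=\frac{-\langle Du,T'\rangle+T_{n+1}}{\sqrt{1+|Du|^2}}$. *)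

(* Defs.v *)
From mathcomp Require Import all_boot all_order all_algebra.
From mathcomp Require Import all_classical all_reals all_analysis.

Set Implicit Arguments.
Unset Strict Implicit.
Unset Printing Implicit Defensive.

Import Order.TTheory GRing.Theory Num.Theory.
Import numFieldNormedType.Exports.

Local Open Scope classical_set_scope.
Local Open Scope ring_scope.

(* The norm `|x| of 'rV[R]_n is the sup norm, hence the Euclidean one here.
   (The induced topologies agree, so continuity and 'D_v are the library's.) *)
Definition dot (R : realType) (n : nat) (x y : 'rV[R]_n) : R :=
  \sum_(i < n) x 0 i * y 0 i.

Definition enorm (R : realType) (n : nat) (x : 'rV[R]_n) : R :=
  Num.sqrt (dot x x).

(* The filter of |x| -> oo. *)
Definition at_infinity (R : realType) (n : nat) : set_system 'rV[R]_n :=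
  filter_from setT (fun M : R => [set x | M < enorm x]).
Arguments at_infinity {R n}.

Global Instance at_infinity_filter (R : realType) (n : nat) :
  Filter (@at_infinity R n).
Proof.
apply: filter_from_filter; first by exists 0.
move=> M N _ _; exists (Num.max M N) => // x /=.
by rewrite gt_max => /andP[].
Qed.

Canonical at_infinity_filter_on (R : realType) (n : nat) :=
  FilterType (@at_infinity R n) (at_infinity_filter R n).

Definition partial (R : realType) (n : nat) (i : 'I_n) (f : 'rV[R]_n -> R) :
    'rV[R]_n -> R :=
  'D_(delta_mx 0 i) f.

(* 'D_v is a junk value where the limit does not exist, so existence is part of
   the definition; s ranges over all multi-indices, written as lists. *)
Definition smooth (R : realType) (n : nat) (f : 'rV[R]_n -> R) : Prop :=
  forall s : seq 'I_n,
    continuous (foldr (@partial R n) f s) /\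
    forall (i : 'I_n) (x : 'rV[R]_n),
      derivable (foldr (@partial R n) f s) x (delta_mx 0 i).

Definition gradient (R : realType) (n : nat) (u : 'rV[R]_n -> R)
    (x : 'rV[R]_n) : 'rV[R]_n :=
  \row_(i < n) partial i u x.

Definition area_factor (R : realType) (n : nat) (u : 'rV[R]_n -> R)
    (x : 'rV[R]_n) : R :=
  Num.sqrt (1 + enorm (gradient u x) ^+ 2).

(* R^n.+1 is represented by 'rV[R]_(n + 1), with (y, t) written row_mx y t%:M. *)
Definition graph (R : realType) (n : nat) (u : 'rV[R]_n -> R) :
    set 'rV[R]_(n + 1) :=
  [set row_mx x (u x)%:M | x in [set: 'rV[R]_n]].

Definition e_last (R : realType) (n : nat) : 'rV[R]_(n + 1) :=
  delta_mx 0 (rshift n 0).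
Arguments e_last {R n}.

(* The normal and the mean curvature at the point (x, u x) of the graph. *)
Definition normal (R : realType) (n : nat) (u : 'rV[R]_n -> R)
    (x : 'rV[R]_n) : 'rV[R]_(n + 1) :=
  (area_factor u x)^-1 *: row_mx (- gradient u x) 1%:M.

Definition mean_curvature (R : realType) (n : nat) (u : 'rV[R]_n -> R)
    (x : 'rV[R]_n) : R :=
  \sum_(i < n) partial i (fun y => partial i u y / area_factor u y) x.

Definition translator (R : realType) (n : nat) (u : 'rV[R]_n -> R)
    (T : 'rV[R]_(n + 1)) : Prop :=
  forall x : 'rV[R]_n, mean_curvature u x = dot (normal u x) T.

Definition hyperplane (R : realType) (m : nat) (S : set 'rV[R]_m) : Prop :=
  exists (a : 'rV[R]_m) (c : R), a != 0 /\ S = [set p | dot a p = c].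

(* Main.v *)
Require Import Defs.
From HB Require Import structures.
From mathcomp Require Import all_boot all_order all_algebra.
From mathcomp Require Import all_classical all_reals all_analysis.
From mathcomp Require Import ring lra.

Set Implicit Arguments.
Unset Strict Implicit.
Unset Printing Implicit Defensive.

Import Order.TTheory GRing.Theory Num.Theory.
Import numFieldNormedType.Exports.

Local Open Scope classical_set_scope.
Local Open Scope ring_scope.

(** Let W = sqrt(1 + |Du|^2), let nu = (-Du, 1)/W be the upward normal, extended to R^(n+1) by
    vertical translation, and let A be the second fundamental form of the graph. The theorem
    follows from A = 0, for then nu is constant and u is affine (gradient_const,
    affine_graph_hyperplane). That A vanishes is a maximum principle argument in the manner of
    the interior curvature estimates of Ecker and Huisken for mean curvature flow.

    Let L be the drift Laplacian of the graph, the Laplacian plus the derivative along the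
    tangential part of T (dlap), and let Γ be its carré du champ (cdc). The translator equation
    gives L nu = - |A|^2 nu (dlap_nu). Together with the Bochner formula for L
    (bochner_formula) this implies Simons' identity L |A|^2 = 2 |DA|^2 - 2 |A|^4 (simons). As 1/W is a component of nu,
    the functions w = W^2 and g = |A|^2 W^2 satisfy
      L g >= 2 Γ(log W, g)   and   L w = 2 g + 6 Γ(W, W)
    (dlap_W2Q, dlap_W2). If 2 w <= K on the ball of radius rho around c, consider eta g / (K - w)
    with eta = (rho^2 - |x - c|^2)^2. At its maximum the term 2 g in L w dominates the error
    terms coming from eta, and one obtains a bound for g(c) by a multiple of K / rho + (K / rho)^2
    (max_point_bound, interior_estimate). The first of the two is due to the drift T. The growth
    condition on Du allows K to be a multiple of sqrt(rho), so rho -> oo gives g(c) = 0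
    (growth_normA2).

    The curvature identities are proved in an arbitrary commutative ring with commuting
    derivations (derivations), for a unit vector nu of ring elements. They are then applied to the
    ring of smooth functions on R^n with the partial derivatives and, for the vertical direction,
    the zero derivation (smooth_fun, smooth_der). Using nu in R^(n+1) and the projection
    P = 1 - nu nu^T in place of the metric of the graph keeps the formulas free of Christoffel
    symbols and of inverse metrics. *)

(** * Derivatives along lines *)

Section Lines.
Variables (R : realType) (V : normedModType R).
Implicit Types (f g : V -> R) (x v w : V).

Lemma is_derive_line f x v (t d : R) : is_derive (t *: v + x) v f d ->
  is_derive t 1 (fun s : R => f (s *: v + x)) d.
Proof.
move=> [df dfE].
have E : (fun h : R => h^-1 *: (((fun s : R => f (s *: v + x)) \o shift t) (h *: 1)
    - f (t *: v + x))) =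
  (fun h => h^-1 *: ((f \o shift (t *: v + x)) (h *: v) - f (t *: v + x))).
  by apply/funext => h /=; rewrite [h *: 1]mulr1 scalerDl addrA.
by split; [rewrite /derivable E | rewrite /derive E].
Qed.

Lemma MVT_line f (df : V -> R) v x (h : R) :
  (forall y, is_derive y v f (df y)) ->
  exists2 th : R, 0 < th < 1 &
    f (h *: v + x) - f x = h * df ((th * h) *: v + x).
Proof.
move=> fd; pose g (s : R) := f (s *: v + x).
have gd (t : R) : is_derive t (1 : R) g (df (t *: v + x)) by exact: is_derive_line.
have gc : continuous g.
  move=> t; apply/differentiable_continuous/derivable1_diffP.
  by have [] := gd t.
have g0 : g 0 = f x by rewrite /g scale0r add0r.
have [h0|h0|->] := ltgtP h 0; last first.
- exists 2^-1; first by rewrite invr_gt0 ltr0n invf_lt1 ?ltr1n.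
  by rewrite scale0r add0r subrr mul0r.
- have [c] := MVT h0 (fun t _ => gd t) (continuous_subspaceT gc).
  rewrite in_itv /= => /andP[c0 ch]; rewrite g0 subr0 => E.
  exists (c / h); first by rewrite divr_gt0 //= ltr_pdivrMr // mul1r.
  by rewrite divfK ?gt_eqF // mulrC -E.
- have [c] := MVT h0 (fun t _ => gd t) (continuous_subspaceT gc).
  rewrite in_itv /= => /andP[ch c0]; rewrite g0 sub0r => E.
  exists (c / h); first by rewrite -divrNN divr_gt0 ?oppr_gt0 //= ltr_pdivrMr ?oppr_gt0// mul1r ltrN2.
  rewrite divfK ?lt_eqF // mulrC; apply: oppr_inj; rewrite opprB E; ring.
Qed.

Lemma small_scale (c : R -> R) (a : R) v : (forall h, `|c h| <= a * `|h|) ->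
  (fun h => c h *: v) @ (0 : R)^' --> (0 : V).
Proof.
move=> cE; rewrite -[X in _ --> X](scale0r v); apply: cvgZr_tmp.
have A : (fun h : R => a * `|h|) @ (0 : R)^' --> (0 : R).
  have : (fun h : R => a * `|h|) @ (0 : R)^' --> a * `|0 : R|.
    by apply: cvgMr; apply: cvg_norm; exact: nbhs_dnbhs.
  by rewrite normr0 mulr0.
apply: (@squeeze_cvgr _ _ _ _ (fun h => - (a * `|h|)) (fun h => a * `|h|)) => //.
- by near=> h; rewrite -ler_norml.
- by rewrite -oppr0; apply: cvgN; rewrite ?oppr0.
Unshelve. all: by end_near. Qed.

Lemma line_cvg x v : (fun h : R => h *: v + x) @ (0 : R)^' --> x.
Proof.
have B : (fun h : R => h *: v) @ (0 : R)^' --> (0 : V).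
  by apply: (@small_scale _ 1) => h; rewrite mul1r.
by rewrite -[X in _ --> X]add0r; apply: cvgD => //; exact: cvg_cst.
Qed.

(** The increment along v + a w is the increment along v plus one along w from the displaced
    point; by the mean value theorem the latter is a value of g near x, so continuity of g at x
    suffices. Adding one coordinate direction at a time yields all directional derivatives of
    a function with continuous partial derivatives. *)
Lemma is_derive_dirD f (g : V -> R) x v w (a d : R) :
  is_derive x v f d -> (forall y, is_derive y w f (g y)) ->
  {for x, continuous g} -> is_derive x (v + a *: w) f (d + a * g x).
Proof.
move=> [fv fvE] fw gc.
have /choice[th H] : forall h : R, exists th : R, 0 < th < 1 /\
    f ((h * a) *: w + (h *: v + x)) - f (h *: v + x)
     = h * a * g ((th * (h * a)) *: w + (h *: v + x)).
  by move=> h; have [th ? ?] := MVT_line (h *: v + x) (h * a) fw; exists th.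
suff C : (fun h : R => h^-1 *: ((f \o shift x) (h *: (v + a *: w)) - f x)) @ 0^'
    --> d + a * g x.
  by split; [apply/cvg_ex; exists (d + a * g x) | exact: cvg_lim].
have gl : (fun h => g ((th h * (h * a)) *: w + (h *: v + x))) @ (0 : R)^' --> g x.
  have A : (fun h => (th h * (h * a)) *: w) @ (0 : R)^' --> (0 : V).
    apply: (@small_scale _ `|a|) => h; rewrite !normrM.
    rewrite [`|h| * _]mulrC ler_piMl ?mulr_ge0 //.
    by have [/andP[? ?] _] := H h; rewrite ger0_norm ?ltW.
  have B : (fun h => h *: v) @ (0 : R)^' --> (0 : V).
    by apply: (@small_scale _ 1) => h; rewrite mul1r.
  have : (fun h => (th h * (h * a)) *: w + (h *: v + x)) @ (0 : R)^' --> x.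
    by rewrite -[X in _ --> X]add0r -[in X in _ --> X](add0r x);
       apply: cvgD => //; apply: cvgD => //; exact: cvg_cst.
  by move=> L; apply: (cvg_comp _ _ L gc).
have C : (fun h : R => h^-1 *: ((f \o shift x) (h *: v) - f x) +
    a * g ((th h * (h * a)) *: w + (h *: v + x))) @ 0^' --> d + a * g x.
  by apply: cvgD; [rewrite -fvE; exact: fv | exact: cvgMr].
apply: cvg_trans C; apply: near_eq_cvg; near=> h.
have h0 : h != 0 by near: h; exact: nbhs_dnbhs_neq.
have [_ E] := H h.
have -> : (f \o shift x) (h *: (v + a *: w)) = f (h *: v + x)
   + h * a * g ((th h * (h * a)) *: w + (h *: v + x)).
  by rewrite -E [RHS]addrC subrK /= scalerDr scalerA addrAC addrC.
have Z (y z : R) : y *: z = y * z by [].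
by rewrite !Z /=; field.
Unshelve. all: by end_near. Qed.

Lemma line_cvg0 x v : (fun t : R => t *: v + x) @ (0 : R) --> x.
Proof.
rewrite -[X in _ --> X]add0r -[in X in _ --> X](scale0r v).
by apply: cvgD; [exact: scalel_continuous | exact: cvg_cst].
Qed.

Lemma local_max_deriv0 f (g : V -> R) x v : (forall y, is_derive y v f (g y)) ->
  (\forall y \near x, f y <= f x) -> g x = 0.
Proof.
move=> fg fmax; pose F (s : R) := f (s *: v + x).
have Fd (t : R) : is_derive t (1 : R) F (g (t *: v + x)) by exact: is_derive_line.
have N : \forall t \near (0 : R), f (t *: v + x) <= f x := @line_cvg0 x v _ fmax.
have /nbhs_ballP[r /= r0 rP] := N.
have D0 : is_derive (0 : R) (1 : R) F 0.
  apply: (@derive1_at_max R F (- r) r 0).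
  - by rewrite ge0_cp // ltW.
  - by move=> t _; have [] := Fd t.
  - by rewrite in_itv /= oppr_lt0 r0.
  - move=> t; rewrite in_itv /= => /andP[t1 t2]; rewrite /F scale0r add0r.
    by apply: rP; rewrite /ball /= sub0r normrN ltr_norml t1.
have [_ E1] := Fd 0; have [_ E2] := D0.
by rewrite -[RHS]E2 E1 scale0r add0r.
Qed.

(** If h x were positive, then g, which vanishes at x, would be positive just after x on the line,
    and f would increase there. *)
Lemma local_max_deriv2 f (g h : V -> R) x v :
  (forall y, is_derive y v f (g y)) -> (forall y, is_derive y v g (h y)) ->
  {for x, continuous h} -> (\forall y \near x, f y <= f x) -> h x <= 0.
Proof.
move=> fg gh hc fmax; have g0 := local_max_deriv0 fg fmax.
rewrite leNgt; apply/negP => hx.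
have hpos : \forall y \near x, 0 < h y by exact: (@cvgr_gt R _ _ _ _ _ hc _ hx).
have N : \forall t \near (0 : R), f (t *: v + x) <= f x /\ 0 < h (t *: v + x).
  exact: (@line_cvg0 x v _ (filterI fmax hpos)).
have /nbhs_ballP[r /= r0 rP] := N.
have inr t : 0 < t -> t < r -> f (t *: v + x) <= f x /\ 0 < h (t *: v + x).
  by move=> t0 tr; apply: rP; rewrite /ball /= sub0r normrN gtr0_norm.
have r2 : 0 < r / 2 by rewrite divr_gt0.
have r2r : r / 2 < r by rewrite ltr_pdivrMr // ltr_pMr // ltr1n.
have [t1 /andP[t10 t11] E1] := MVT_line x (r / 2) fg.
have [t2 /andP[t20 t21] E2] := MVT_line x (t1 * (r / 2)) gh.
have [+ _] := inr _ r2 r2r; rewrite -subr_le0 E1 leNgt => /negP; apply.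
apply: mulr_gt0 => //; move: E2; rewrite g0 subr0 => ->.
have p1 : 0 < t1 * (r / 2) by rewrite mulr_gt0.
apply: mulr_gt0 => //; apply: (inr _ _ _).2; first by rewrite mulr_gt0.
apply: lt_trans r2r; apply: (@lt_trans _ _ (t1 * (r / 2))); last by rewrite gtr_pMl.
by rewrite gtr_pMl.
Qed.

End Lines.

(** * Smooth functions *)

Section Smooth.
Variables (R : realType) (n : nat).
Local Notation V := 'rV[R]_n.
Implicit Types (f g : V -> R) (x v w : V) (i j : 'I_n).
Local Notation e i := (delta_mx 0 i : V).

(** Peeling off the innermost derivative makes smoothness recursive, which is the form that
    inductions on the order of differentiation use. *)
Lemma smoothP f : smooth f <->
  [/\ continuous f, forall i x, derivable f x (e i) & forall i, smooth (partial i f)].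
Proof.
split=> [sf|[cf df sf] s].
  split; first by have [] := sf [::].
    by move=> i x; have [_] := sf [::]; apply.
  move=> i s; have := sf (rcons s i).
  by rewrite foldr_rcons.
case/lastP: s => [|s i]; first by split.
by rewrite foldr_rcons; exact: sf.
Qed.

Lemma smooth_continuous f : smooth f -> continuous f.
Proof. by case/smoothP. Qed.
Lemma smooth_derivable f i x : smooth f -> derivable f x (e i).
Proof. by case/smoothP. Qed.
Lemma smooth_partial f i : smooth f -> smooth (partial i f).
Proof. by case/smoothP. Qed.
Lemma smooth_is_derive f i x : smooth f -> is_derive x (e i) f (partial i f x).
Proof. by move=> sf; split => //; exact: smooth_derivable. Qed.

Lemma smooth_is_derive_dir f x v : smooth f ->
  is_derive x v f (\sum_i v 0 i * partial i f x).
Proof.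
move=> sf; rewrite [v in is_derive _ v]row_sum_delta.
elim/big_rec2: _ => [|i d w _ dw]; first exact: is_derive0.
rewrite addrC [X in is_derive _ _ _ X]addrC; apply: is_derive_dirD => //.
  by move=> y; exact: smooth_is_derive.
by apply: smooth_continuous; exact: smooth_partial.
Qed.

(** Both mixed derivatives are limits of the same second difference quotient, to which the mean
    value theorem is applied in the two possible orders. *)
Lemma partialC f i j : smooth f -> partial i (partial j f) = partial j (partial i f).
Proof.
move=> sf; apply/funext => x.
(* the second difference, symmetric in k and l *)
pose Dl k l (h : R) := f (h *: e k + (h *: e l + x)) - f (h *: e k + x)
  - f (h *: e l + x) + f x.
have mixed k l : exists2 y : R -> V, y @ (0 : R)^' --> x &
    forall h, Dl k l h = h * h * partial l (partial k f) (y h).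
  have /choice[th H] : forall h : R, exists th : R * R, [/\ 0 < th.1 < 1, 0 < th.2 < 1
    & Dl k l h = h * h * partial l (partial k f)
        ((th.2 * h) *: e l + ((th.1 * h) *: e k + x))].
    move=> h; pose phi y := f (y + h *: e l) - f y.
    pose dphi y := partial k f (y + h *: e l) - partial k f y.
    have dphiP y : is_derive y (e k) phi (dphi y).
      have d1 := smooth_is_derive k y sf.
      have [d2 E2] := smooth_is_derive k (y + h *: e l) sf.
      have S : (fun t : R => t^-1 *: (((fun y => f (y + h *: e l)) \o shift y) (t *: e k)
          - f (y + h *: e l))) =
        (fun t => t^-1 *: ((f \o shift (y + h *: e l)) (t *: e k) - f (y + h *: e l))).
        by apply/funext => t /=; rewrite addrA.
      have d3 : is_derive y (e k) (fun y => f (y + h *: e l)) (partial k f (y + h *: e l)).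
        by split; [rewrite /derivable S | rewrite /derive S].
      exact: is_deriveB.
    have [t1 t1P E1] := MVT_line x h dphiP.
    have dk y : is_derive y (e l) (partial k f) (partial l (partial k f) y).
      by apply: smooth_is_derive; exact: smooth_partial.
    have [t2 t2P E2] := MVT_line ((t1 * h) *: e k + x) h dk.
    exists (t1, t2); split => //=; rewrite -mulrA -E2.
    have -> : Dl k l h = phi (h *: e k + x) - phi x.
      rewrite /Dl /phi -!addrA [x + _]addrC; ring.
    by rewrite E1 /dphi [h *: e l + _]addrC.
  have sm (u : R -> R) v : (forall h, 0 < u h < 1) ->
      (fun h => (u h * h) *: v) @ (0 : R)^' --> (0 : V).
    move=> uP; apply: (@small_scale _ _ _ 1) => h; rewrite mul1r normrM ler_piMl //.
    by have /andP[? ?] := uP h; rewrite ger0_norm ltW.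
  exists (fun h => ((th h).2 * h) *: e l + (((th h).1 * h) *: e k + x)).
    rewrite -[X in _ --> X]add0r -[in X in _ --> X](add0r x).
    apply: cvgD; first by apply: sm => h; have [] := H h.
    by apply: cvgD; [apply: sm => h; have [] := H h | exact: cvg_cst].
  by move=> h; have [] := H h.
have [y yx Ey] := mixed i j; have [z zx Ez] := mixed j i.
have cc k l : {for x, continuous (partial k (partial l f))}.
  by apply: smooth_continuous; apply/smooth_partial/smooth_partial.
have A : (fun h => partial i (partial j f) (z h)) @ (0 : R)^'
    --> partial i (partial j f) x := cvg_comp z _ zx (cc i j).
have B : (fun h => partial j (partial i f) (y h)) @ (0 : R)^'
    --> partial j (partial i f) x := cvg_comp y _ yx (cc j i).
have C : (fun h => partial i (partial j f) (z h)) @ (0 : R)^'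
    --> partial j (partial i f) x.
  apply: cvg_trans B; apply: near_eq_cvg; near=> h.
  have h0 : h != 0 by near: h; exact: nbhs_dnbhs_neq.
  apply: (@mulfI _ (h * h)); first by rewrite mulf_neq0.
  have S : h *: e j + (h *: e i + x) = h *: e i + (h *: e j + x) by exact: addrCA.
  have eqD : Dl i j h = Dl j i h by rewrite /Dl S [X in X + _ = _]addrAC.
  exact: etrans (esym (Ey h)) (etrans eqD (Ez h)).
exact: (@norm_cvg_unique _ _ _ _ _ _ A C).
Unshelve. all: by end_near. Qed.
End Smooth.

Section Closure.
Variables (R : realType) (n : nat).
Local Notation V := 'rV[R]_n.
Implicit Types (f g : V -> R) (x v w : V) (i j : 'I_n) (k : nat).
Local Notation e i := (delta_mx 0 i : V).

(** Differentiability up to order k. Closure properties go by induction on k, since the derivative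
    of a product (an inverse, a square root) contains the factors again, at lower order. *)
Fixpoint Ck k f : Prop :=
  [/\ continuous f, forall i x, derivable f x (e i) &
      if k is k'.+1 then forall i, Ck k' (partial i f) else True].

Lemma CkS k f : Ck k.+1 f -> Ck k f.
Proof.
elim: k f => [|k IH] f; first by case.
by case=> cf df sf; split => // i; exact: IH.
Qed.

Lemma smooth_Ck f : smooth f <-> forall k, Ck k f.
Proof.
split=> [sf k|Cf s].
  elim: k f sf => [|k IH] f /smoothP[cf df sf]; split => // i; exact: IH.
suff : continuous (foldr (@partial R n) f s) /\
    (forall i x, derivable (foldr (@partial R n) f s) x (e i)) by [].
elim/last_ind: s f Cf => [|s i IH] f Cf; first by have [] := Cf 0.
rewrite foldr_rcons; apply: IH => k; by have [_ _] := Cf k.+1; apply.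
Qed.

Lemma Ck_cst k (c : R) : Ck k (cst c).
Proof.
elim: k c => [|k IH] c; (split; [exact: cst_continuous |
  by move=> i x; have [] := is_derive_cst c x (e i) | ]) => //.
move=> i; rewrite (_ : partial i _ = cst 0) //.
by apply/funext => x; exact: derive_cst.
Qed.

Lemma CkD k f g : Ck k f -> Ck k g -> Ck k (f + g).
Proof.
elim: k f g => [|k IH] f g [cf df sf] [cg dg sg]; (split;
  [by move=> x; exact: (continuousD (cf x) (cg x))
  |by move=> i x; exact: derivableD | ]) => //.
move=> i; have -> : partial i (f + g) = partial i f + partial i g.
  by apply/funext => x; exact: deriveD.
by apply: IH; [exact: sf | exact: sg].
Qed.

Lemma CkM k f g : Ck k f -> Ck k g -> Ck k (f * g).
Proof.
elim: k f g => [|k IH] f g Cf Cg; have [cf df sf] := Cf; have [cg dg sg] := Cg;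
  (split; [by move=> x; exact: (continuousM (cf x) (cg x))
  |by move=> i x; exact: derivableM | ]) => //.
move=> i; have -> : partial i (f * g) = f * partial i g + g * partial i f.
  by apply/funext => x; exact: deriveM.
have ? := CkS Cf; have ? := CkS Cg.
by apply: CkD; apply: IH => //; [exact: sg | exact: sf].
Qed.

Lemma CkV k f : (forall x, f x != 0) -> Ck k f -> Ck k (fun x => (f x)^-1).
Proof.
move=> f0; elim: k => [|k IH] Cf; have [cf df sf] := Cf;
  (split; [by move=> x; apply: (continuousV _ (cf x))
  |by move=> i x; exact: derivableV | ]) => //.
move=> i; have -> : partial i (fun x => (f x)^-1) =
    cst (-1) * partial i f * ((fun x => (f x)^-1) * (fun x => (f x)^-1)).
  apply/funext => x; rewrite /partial deriveV // [LHS]mulrC.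
  by rewrite !mulrfctE /cst -exprVn expr2; ring.
have ? := CkS Cf.
by apply: CkM; [apply: CkM; [exact: Ck_cst | exact: sf] | apply: CkM; exact: IH].
Qed.

Lemma is_derive_sqrt_fun f x v d : 0 < f x -> continuous f -> is_derive x v f d ->
  is_derive x v (fun y => Num.sqrt (f y)) (d / (2 * Num.sqrt (f x))).
Proof.
move=> f0 cf [fd dE]; set s := fun y => Num.sqrt (f y).
have cs : continuous s by move=> y; apply: continuous_comp; [exact: cf|exact: sqrt_continuous].
have s0 : 0 < s x by rewrite sqrtr_gt0.
have C : (fun h : R => h^-1 *: ((f \o shift x) (h *: v) - f x) *
     (s (h *: v + x) + s x)^-1) @ 0^' --> d / (2 * s x).
  apply: cvgM; first by rewrite -dE; exact: fd.
  apply: cvgV; first by rewrite mulf_neq0 // gt_eqF.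
  rewrite mulr_natl mulr2n; apply: cvgD; last exact: cvg_cst.
  exact: (cvg_comp _ _ (@line_cvg _ _ x v) (cs x)).
have fpos : \forall h \near (0 : R)^', 0 < f (h *: v + x).
  have L : (fun h : R => f (h *: v + x)) @ 0^' --> f x.
    exact: (cvg_comp _ _ (@line_cvg _ _ x v) (cf x)).
  exact: (@cvgr_gt R _ _ _ _ _ L _ f0).
suff E : (fun h : R => h^-1 *: ((s \o shift x) (h *: v) - s x)) @ 0^' --> d / (2 * s x).
  by split; [apply/cvg_ex; exists (d / (2 * s x)) | exact: cvg_lim].
apply: cvg_trans C; apply: near_eq_cvg; near=> h.
have fh : 0 < f (h *: v + x) by near: h.
have sh : 0 < s (h *: v + x) by rewrite sqrtr_gt0.
rewrite /=; have -> : f (h *: v + x) - f x =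
    (s (h *: v + x) - s x) * (s (h *: v + x) + s x).
  by rewrite -subr_sqr /s !sqr_sqrtr ?ltW.
have Z (y z : R) : y *: z = y * z by [].
by rewrite !Z mulrA mulfK // gt_eqF // addr_gt0.
Unshelve. all: by end_near. Qed.

Lemma Ck_sqrt k f : (forall x, 0 < f x) -> Ck k f -> Ck k (fun x => Num.sqrt (f x)).
Proof.
move=> f0; have s0 x : Num.sqrt (f x) != 0 by rewrite gt_eqF // sqrtr_gt0.
elim: k => [|k IH] Cf; have [cf df sf] := Cf; (split;
  [by move=> x; apply: continuous_comp; [exact: cf|exact: sqrt_continuous]
  |by move=> i x; have [] := is_derive_sqrt_fun (f0 x) cf (derivableP (df i x)) | ]) => //.
move=> i; have -> : partial i (fun x => Num.sqrt (f x)) =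
    partial i f * (cst 2^-1 * (fun x => (Num.sqrt (f x))^-1)).
  apply/funext => x; have [_] := is_derive_sqrt_fun (f0 x) cf (derivableP (df i x)).
  by move=> E; rewrite [LHS]E invfM.
apply: CkM; first exact: sf.
apply: CkM; first exact: Ck_cst.
by apply: CkV => //; apply: IH; exact: CkS.
Qed.

Lemma coord_is_derive (l i : 'I_n) x :
  is_derive x (e i) (fun y : V => y 0 l) (l == i)%:R.
Proof.
suff E : (fun h : R => h^-1 *: (((fun y : V => y 0 l) \o shift x) (h *: e i) - x 0 l))
    @ (0 : R)^' --> ((l == i)%:R : R).
  by split; [apply/cvg_ex; exists (l == i)%:R | exact: cvg_lim].
apply: (@cvg_trans _ ((fun=> (l == i)%:R) @ (0 : R)^')); last exact: cvg_cst.
apply: near_eq_cvg; near=> h.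
have h0 : h != 0 by near: h; exact: nbhs_dnbhs_neq.
have Z (y z : R) : y *: z = y * z by [].
by rewrite Z /= !mxE addrK eqxx /= mulrA mulVf // mul1r.
Unshelve. all: by end_near. Qed.

Lemma smooth_cst (c : R) : smooth (cst c : V -> R).
Proof. by apply/smooth_Ck => k; exact: Ck_cst. Qed.

Lemma smooth_coord (l : 'I_n) : smooth (fun y : V => y 0 l).
Proof.
apply/smoothP; split.
- exact: coord_continuous.
- by move=> i x; have [] := coord_is_derive l i x.
- move=> i; rewrite (_ : partial i _ = cst (l == i)%:R); first exact: smooth_cst.
  by apply/funext => x; have [_] := coord_is_derive l i x.
Qed.

Lemma smoothD f g : smooth f -> smooth g -> smooth (f + g).
Proof. by move=> /smooth_Ck Cf /smooth_Ck Cg; apply/smooth_Ck => k; exact: CkD. Qed.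
Lemma smoothM f g : smooth f -> smooth g -> smooth (f * g).
Proof. by move=> /smooth_Ck Cf /smooth_Ck Cg; apply/smooth_Ck => k; exact: CkM. Qed.
Lemma smoothN f : smooth f -> smooth (- f).
Proof.
move=> sf; have -> : - f = cst (-1) * f.
  by apply/funext => x; rewrite mulrfctE /cst mulN1r.
exact: smoothM (smooth_cst _) sf.
Qed.
Lemma smoothV f : (forall x, f x != 0) -> smooth f -> smooth (fun x => (f x)^-1).
Proof. by move=> f0 /smooth_Ck Cf; apply/smooth_Ck => k; exact: CkV. Qed.
Lemma smooth_sqrt f : (forall x, 0 < f x) -> smooth f ->
  smooth (fun x => Num.sqrt (f x)).
Proof. by move=> f0 /smooth_Ck Cf; apply/smooth_Ck => k; exact: Ck_sqrt. Qed.
Lemma smooth_sum I (r : seq I) (F : I -> V -> R) :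
  (forall a, smooth (F a)) -> smooth (fun x => \sum_(a <- r) F a x).
Proof.
move=> sF; elim: r => [|a r IH].
  by under eq_fun do rewrite big_nil; exact: smooth_cst.
under eq_fun do rewrite big_cons; exact: smoothD (sF a) IH.
Qed.

Lemma partialD i f g : smooth f -> smooth g ->
  partial i (f + g) = partial i f + partial i g.
Proof. by move=> sf sg; apply/funext => x; apply: deriveD; exact: smooth_derivable. Qed.
Lemma partialM i f g : smooth f -> smooth g ->
  partial i (f * g) = partial i f * g + f * partial i g.
Proof.
move=> sf sg; apply/funext => x; rewrite [LHS]deriveM; try exact: smooth_derivable.
by rewrite [LHS]addrC; congr (_ + _); exact: mulrC.
Qed.

Lemma partial_cst i (c : R) : partial i (cst c : V -> R) = cst 0.
Proof. by apply/funext => x; exact: derive_cst. Qed.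
Lemma partialZ i (c : R) f : smooth f ->
  partial i (fun x => c * f x) = (fun x => c * partial i f x).
Proof.
move=> sf; have := partialM i (smooth_cst c) sf; rewrite partial_cst.
have -> : cst 0 * f = 0 by apply/funext => x; exact: mul0r.
by rewrite add0r.
Qed.
Lemma partial_sum i I (r : seq I) (F : I -> V -> R) : (forall a, smooth (F a)) ->
  partial i (fun x => \sum_(a <- r) F a x) = (fun x => \sum_(a <- r) partial i (F a) x).
Proof.
move=> sF; elim: r => [|a r IH].
  under eq_fun do rewrite big_nil; rewrite [LHS]partial_cst.
  by apply/funext => x; rewrite big_nil.
under eq_fun do rewrite big_cons; rewrite [LHS]partialD //; last exact: smooth_sum.
by rewrite IH; apply/funext => x; rewrite big_cons.
Qed.

(** The second derivative is needed in every direction v, as the operator dlap below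
    has variable coefficients. *)
Lemma local_max_test f x : smooth f -> (\forall y \near x, f y <= f x) ->
  (forall i, partial i f x = 0) /\
  forall v, \sum_i v 0 i * \sum_j v 0 j * partial j (partial i f) x <= 0.
Proof.
move=> sf fmax.
have first_order v : \sum_i v 0 i * partial i f x = 0.
  exact: (local_max_deriv0 (fun y => smooth_is_derive_dir y v sf) fmax).
split=> [i|v].
  rewrite -[RHS](first_order (e i)) (bigD1 i) //= big1 ?addr0 => [|j ji].
    by rewrite mxE !eqxx mul1r.
  by rewrite mxE eqxx (negPf ji) mul0r.
pose g y := \sum_i v 0 i * partial i f y.
have svf i : smooth (fun y => v 0 i * partial i f y).
  apply: (@smoothM (cst (v 0 i)) _ (smooth_cst _)); exact: smooth_partial.
have sg : smooth g by exact: smooth_sum.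
have fg y : is_derive y v f (g y) by exact: smooth_is_derive_dir.
pose h y := \sum_j v 0 j * partial j g y.
have gh y : is_derive y v g (h y) by exact: smooth_is_derive_dir.
have hc : {for x, continuous h}.
  apply: smooth_continuous; apply: smooth_sum => j.
  by apply: (@smoothM (cst (v 0 j)) _ (smooth_cst _)); exact: smooth_partial.
have -> : \sum_i v 0 i * \sum_j v 0 j * partial j (partial i f) x = h x.
  rewrite /h /g; under eq_bigr do rewrite mulr_sumr.
  rewrite exchange_big /=; apply: eq_bigr => j _; rewrite partial_sum //.
  rewrite mulr_sumr; apply: eq_bigr => i _.
  have E := congr1 (fun F => F x) (partialZ j (v 0 i) (smooth_partial i sf)).
  exact: etrans (mulrCA _ _ _) (esym (congr1 ( *%R (v 0 j)) E)).
exact: (local_max_deriv2 fg gh hc fmax).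
Qed.
End Closure.

(** * Curvature identities in a differential ring *)

Lemma mxtraceN (F : pzRingType) n (A : 'M[F]_n) : \tr (- A) = - \tr A.
Proof. exact: raddfN. Qed.

Lemma mxtraceB (F : pzRingType) n (A B : 'M[F]_n) : \tr (A - B) = \tr A - \tr B.
Proof. exact: raddfB. Qed.

Lemma mxtrace_sum (F : pzRingType) n I (r : seq I) (A : I -> 'M[F]_n) :
  \tr (\sum_(i <- r) A i) = \sum_(i <- r) \tr (A i).
Proof. exact: raddf_sum. Qed.

Section InnerProduct.
Variables (F : comNzRingType) (m : nat).
Implicit Types x y z : 'cV[F]_m.
Definition ip x y : F := \tr (x^T *m y).

Lemma ipE x y : ip x y = \sum_a x a 0 * y a 0.
Proof. by rewrite /ip /mxtrace big_ord1 mxE; apply: eq_bigr => a _; rewrite mxE. Qed.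
Lemma ipC x y : ip x y = ip y x.
Proof. by rewrite !ipE; apply: eq_bigr => a _; rewrite mulrC. Qed.
Lemma ipDl x y z : ip (x + y) z = ip x z + ip y z.
Proof. by rewrite /ip linearD mulmxDl linearD. Qed.
Lemma ipDr x y z : ip x (y + z) = ip x y + ip x z.
Proof. by rewrite /ip mulmxDr linearD. Qed.
Lemma ipNl x y : ip (- x) y = - ip x y.
Proof. by rewrite /ip linearN mulNmx linearN. Qed.
Lemma ipNr x y : ip x (- y) = - ip x y.
Proof. by rewrite /ip mulmxN linearN. Qed.
Lemma ipZl c x y : ip (c *: x) y = c * ip x y.
Proof. by rewrite /ip linearZ -scalemxAl linearZ. Qed.
Lemma ipZr c x y : ip x (c *: y) = c * ip x y.
Proof. by rewrite /ip -scalemxAr linearZ. Qed.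
Lemma ip0l y : ip 0 y = 0.
Proof. by rewrite /ip trmx0 mul0mx linear0. Qed.
Lemma ip0r y : ip y 0 = 0.
Proof. by rewrite /ip mulmx0 linear0. Qed.
Lemma ip_mulmx (B : 'M[F]_m) x y : ip x (B *m y) = ip (B^T *m x) y.
Proof. by rewrite /ip trmx_mul trmxK mulmxA. Qed.
Lemma ip_sumr I (r : seq I) x (f : I -> 'cV_m) :
  ip x (\sum_(i <- r) f i) = \sum_(i <- r) ip x (f i).
Proof. by elim/big_rec2: _ => [|i s t _ <-]; rewrite ?ip0r ?ipDr. Qed.
Lemma trace_outer x y : \tr (x *m y^T) = ip y x.
Proof. by rewrite mxtrace_mulC. Qed.
Lemma mulmx_outer x y z : x *m y^T *m z = ip y z *: x.
Proof.
rewrite -mulmxA; have -> : y^T *m z = (ip y z)%:M.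
  by rewrite [LHS]mx11_scalar /ip /mxtrace big_ord1.
by rewrite mul_mx_scalar.
Qed.
End InnerProduct.

(** The form in which simons_square occurs as a sum of squared norms of matrices. *)
Lemma trace_add_outer (F : comNzRingType) m (w : F) (x : 'M[F]_m) (y t : 'cV_m) :
  x^T = x ->
  \tr ((w *: x + t *m y^T)^T *m (w *: x + t *m y^T)) =
  w * w * \tr (x *m x) + w * (2 * ip (x *m y) t) + ip y y * ip t t.
Proof.
move=> xT; rewrite [(_ + _)^T]linearD /= [(_ *: _)^T]linearZ /= trmx_mul trmxK xT.
rewrite mulmxDl !mulmxDr !mxtraceD -!scalemxAl -!scalemxAr !mxtraceZ.
rewrite (mxtrace_mulC (y *m t^T) x) !mulmxA !trace_outer mulmx_outer.
rewrite ipZr [ip y (x *m t)]ip_mulmx xT [ip t (x *m y)]ipC.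
by ring.
Qed.

(** All of calculus that the curvature identities need: once smooth functions are elements of
    a ring, the identities become algebra. *)
Record derivations (F : comNzRingType) (m : nat) := Derivations {
  der :> 'I_m -> F -> F;
  derD : forall a f h, der a (f + h) = der a f + der a h;
  derM : forall a f h, der a (f * h) = der a f * h + f * der a h;
  derC : forall a b f, der a (der b f) = der b (der a f) }.

Section Derivations.
Variables (F : comNzRingType) (m : nat) (D : derivations F m).
Implicit Types (f h : F) (a b : 'I_m).

Lemma der0 a : D a 0 = 0.
Proof. by apply: (addrI (D a 0)); rewrite -derD !addr0. Qed.
Lemma derN a f : D a (- f) = - D a f.
Proof. by apply: (addrI (D a f)); rewrite -derD !subrr der0. Qed.
Lemma derB a f h : D a (f - h) = D a f - D a h.
Proof. by rewrite derD derN. Qed.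
Lemma der1 a : D a 1 = 0.
Proof. by apply: (addrI (D a 1)); rewrite addr0 -{3}[1]mulr1 derM mulr1 mul1r. Qed.
Lemma der_sum a I (r : seq I) (f : I -> F) :
  D a (\sum_(i <- r) f i) = \sum_(i <- r) D a (f i).
Proof. by elim/big_rec2: _ => [|i s t _ <-]; rewrite ?der0 ?derD. Qed.

Lemma der_mulmx a p q r (A : 'M[F]_(p, q)) (B : 'M[F]_(q, r)) :
  map_mx (D a) (A *m B) = map_mx (D a) A *m B + A *m map_mx (D a) B.
Proof.
apply/matrixP => i j; rewrite !mxE der_sum -big_split /=.
by apply: eq_bigr => k _; rewrite derM !mxE.
Qed.
Lemma der_mxtrace a p (A : 'M[F]_p) : D a (\tr A) = \tr (map_mx (D a) A).
Proof. by rewrite der_sum; apply: eq_bigr => k _; rewrite mxE. Qed.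

Definition grad f : 'cV[F]_m := \col_a D a f.
Definition hess f : 'M[F]_m := \matrix_(a, b) D a (D b f).

Lemma gradD f h : grad (f + h) = grad f + grad h.
Proof. by apply/colP => a; rewrite !mxE derD. Qed.
Lemma grad0 : grad 0 = 0.
Proof. by apply/colP => a; rewrite !mxE der0. Qed.
Lemma gradN f : grad (- f) = - grad f.
Proof. by apply/colP => a; rewrite !mxE derN. Qed.
Lemma grad_sum I (r : seq I) (f : I -> F) :
  grad (\sum_(i <- r) f i) = \sum_(i <- r) grad (f i).
Proof. by elim/big_rec2: _ => [|i s t _ <-]; rewrite ?grad0 ?gradD. Qed.
Lemma gradM f h : grad (f * h) = f *: grad h + h *: grad f.
Proof. by apply/colP => a; rewrite !mxE derM; ring. Qed.
Lemma hess_tr f : (hess f)^T = hess f.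
Proof. by apply/matrixP => a b; rewrite !mxE derC. Qed.
Lemma hessD f h : hess (f + h) = hess f + hess h.
Proof. by apply/matrixP => a b; rewrite !mxE !derD. Qed.
Lemma hess0 : hess 0 = 0.
Proof. by apply/matrixP => a b; rewrite !mxE !der0. Qed.
Lemma hessM f h : hess (f * h) =
  f *: hess h + h *: hess f + grad f *m (grad h)^T + grad h *m (grad f)^T.
Proof.
apply/matrixP => a b; rewrite !mxE !big_ord1 !mxE derM derD !derM.
by ring.
Qed.

Section Operator.
Variables (nu T : 'cV[F]_m).
Hypothesis T_const : forall a, map_mx (D a) T = 0.
Hypothesis nu_unit : ip nu nu = 1.

(** The projection onto the tangent space of the graph. It is locked since matching the
    distributivity lemmas would otherwise unfold it into a difference. *)
Definition tproj : 'M[F]_m := locked (1%:M - nu *m nu^T).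
Local Notation P := tproj.
Lemma tproj_def : P = 1%:M - nu *m nu^T. Proof. by rewrite /P -lock. Qed.
(** The carré du champ of dlap: the scalar product of the tangential gradients. *)
Definition cdc f h : F := ip (grad f) (P *m grad h).
(** On functions extended constantly in the vertical direction this is the drift Laplacian of a
    graphical translator, the Laplace-Beltrami operator plus the derivative along the tangential
    part of T. Its coefficients contain no second derivative of u: those in the
    Christoffel symbols cancel with the normal part of T because H = <nu, T>. *)
Definition dlap f : F := \tr (P *m hess f) + ip T (grad f).
Local Notation L := dlap.
Local Notation "'Γ'" := cdc.

Lemma tproj_tr : P^T = P.
Proof. by rewrite tproj_def linearB /= trmx1 trmx_mul trmxK. Qed.
Lemma tproj_nu : P *m nu = 0.
Proof. by rewrite tproj_def mulmxBl mul1mx mulmx_outer nu_unit scale1r subrr. Qed.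
Lemma nu_tproj : nu^T *m P = 0.
Proof. by rewrite -tproj_tr -trmx_mul tproj_nu trmx0. Qed.
Lemma tproj_idem : P *m P = P.
Proof. by rewrite {1}tproj_def mulmxBl mul1mx -mulmxA nu_tproj mulmx0 subr0. Qed.
Lemma tproj_mul q (X : 'M[F]_(m, q)) : P *m X = X - nu *m (nu^T *m X).
Proof. by rewrite tproj_def mulmxBl mul1mx mulmxA. Qed.
Lemma tprojE x : P *m x = x - ip nu x *: nu.
Proof. by rewrite tproj_def mulmxBl mul1mx mulmx_outer. Qed.

Lemma cdcC f h : Γ f h = Γ h f.
Proof. by rewrite /cdc ip_mulmx tproj_tr ipC. Qed.
Lemma cdcDl f g h : Γ (f + g) h = Γ f h + Γ g h.
Proof. by rewrite /cdc gradD ipDl. Qed.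
Lemma cdcMl f g h : Γ (f * g) h = f * Γ g h + g * Γ f h.
Proof. by rewrite /cdc gradM ipDl !ipZl. Qed.
Lemma cdcMr f g h : Γ h (f * g) = f * Γ h g + g * Γ h f.
Proof. by rewrite cdcC cdcMl !(cdcC _ h). Qed.
Lemma cdc_sq f : Γ f f = ip (P *m grad f) (P *m grad f).
Proof. by rewrite ip_mulmx tproj_tr mulmxA tproj_idem ipC. Qed.

Lemma cdc_const c f : grad c = 0 -> Γ c f = 0.
Proof. by move=> c0; rewrite /cdc c0 ip0l. Qed.
Lemma cdcZl c f h : grad c = 0 -> Γ (c * f) h = c * Γ f h.
Proof. by move=> c0; rewrite cdcMl (cdc_const _ c0) mulr0 addr0. Qed.
Lemma cdc_quad c f h : grad c = 0 ->
  Γ (c * f + h) (c * f + h) = c * c * Γ f f + 2 * c * Γ f h + Γ h h.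
Proof.
move=> c0; rewrite cdcDl !(cdcC _ (c * f + h)) !cdcDl !cdcZl // !(cdcC _ (c * f)).
by rewrite !cdcZl //; ring.
Qed.

Lemma dlapD f h : L (f + h) = L f + L h.
Proof. by rewrite /L hessD gradD mulmxDr mxtraceD ipDr; ring. Qed.
Lemma dlap0 : L 0 = 0.
Proof. by rewrite /L hess0 grad0 mulmx0 mxtrace0 ip0r addr0. Qed.
Lemma dlapN f : L (- f) = - L f.
Proof. by apply: (addrI (L f)); rewrite -dlapD !subrr dlap0. Qed.
Lemma dlap_sum I (r : seq I) (f : I -> F) :
  L (\sum_(i <- r) f i) = \sum_(i <- r) L (f i).
Proof. by elim/big_rec2: _ => [|i s t _ <-]; rewrite ?dlap0 ?dlapD. Qed.
Lemma dlapM f h : L (f * h) = f * L h + h * L f + 2 * Γ f h.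
Proof.
rewrite /L hessM gradM !mulmxDr !mxtraceD ipDr !ipZr -!scalemxAr !mxtraceZ.
rewrite !mulmxA !trace_outer -/(cdc h f) -/(cdc f h) (cdcC h f).
by ring.
Qed.

Lemma dlapZ c f : grad c = 0 -> L (c * f) = c * L f.
Proof.
move=> c0; rewrite dlapM (cdc_const _ c0) /L.
have -> : hess c = 0.
  apply/matrixP => a b; rewrite !mxE.
  by have := congr1 (fun v : 'cV_m => v b 0) c0; rewrite !mxE => ->; rewrite der0.
by rewrite c0 mulmx0 mxtrace0 ip0r; ring.
Qed.

Definition dnu : 'M[F]_m := \matrix_(a, b) D a (nu b 0).
Local Notation N := dnu.
(** Up to sign the second fundamental form, as a matrix that kills the normal direction. *)
Definition shape : 'M[F]_m := locked (P *m N).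
Local Notation A := shape.
Lemma tproj_dnu : P *m N = A. Proof. by rewrite /A -lock. Qed.
(** The derivative of nu in direction nu, for the extension of nu to R^(n+1) by vertical
    translation; this is the part of the derivative of nu that the graph does not see. *)
Definition accel : 'cV[F]_m := N^T *m nu.
Local Notation κ := accel.

Lemma dnu_col b : col b N = grad (nu b 0).
Proof. by apply/colP => a; rewrite !mxE. Qed.

Lemma map_nu a : map_mx (D a) nu = (row a N)^T.
Proof. by apply/colP => b; rewrite !mxE. Qed.

Lemma dnu_nu (half : forall x : F, 2 * x = 0 -> x = 0) : N *m nu = 0.
Proof.
apply/colP => a; rewrite mxE [RHS]mxE; apply: half.
transitivity (D a (ip nu nu)); last by rewrite nu_unit der1.
rewrite ipE der_sum mulr_sumr; apply: eq_bigr => b _.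
by rewrite derM !mxE; ring.
Qed.

Lemma der_tproj a :
  map_mx (D a) P = - ((row a N)^T *m nu^T + nu *m row a N).
Proof.
have -> : map_mx (D a) P = - map_mx (D a) (nu *m nu^T).
  rewrite tproj_def; apply/matrixP => i j; rewrite !mxE derB; case: eqP => _; rewrite ?der1 ?der0 sub0r //.
by rewrite der_mulmx -map_trmx map_nu trmxK.
Qed.

(** As T is constant, D_a fails to commute with L only through the derivative of the
    coefficients P. *)
Lemma dlap_grad f : (\col_a L (D a f)) = grad (L f) + 2 *: (N *m hess f *m nu).
Proof.
have E a : (row a N *m hess f *m nu) 0 0 = (N *m hess f *m nu) a 0.
  by rewrite -!row_mul mxE.
have dP a : \tr (map_mx (D a) P *m hess f) = - (2 * (N *m hess f *m nu) a 0).
  rewrite der_tproj mulNmx mulmxDl mxtraceN mxtraceD.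
  have -> : \tr ((row a N)^T *m nu^T *m hess f) = (N *m hess f *m nu) a 0.
    rewrite -mulmxA mxtrace_mulC -mxtrace_tr !trmx_mul !trmxK hess_tr mulmxA.
    by rewrite /mxtrace big_ord1 E.
  have -> : \tr (nu *m row a N *m hess f) = (N *m hess f *m nu) a 0.
    by rewrite -mulmxA mxtrace_mulC /mxtrace big_ord1 E.
  by ring.
apply/colP => a; rewrite mxE [RHS]mxE [grad _ a 0]mxE [X in _ = _ + X]mxE /L derD.
rewrite der_mxtrace der_mulmx mxtraceD dP.
have -> : hess (D a f) = map_mx (D a) (hess f).
  by apply/matrixP => b c; rewrite !mxE (derC _ c a) (derC _ b a).
have -> : D a (ip T (grad f)) = ip T (grad (D a f)).
  rewrite /ip der_mxtrace der_mulmx -map_trmx T_const trmx0 mul0mx add0r.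
  by congr (\tr (_ *m _)); apply/colP => b; rewrite !mxE derC.
by ring.
Qed.

Lemma trace_cols q (X Y : 'M[F]_(m, q)) :
  \tr (X^T *m Y) = \sum_b ip (col b X) (col b Y).
Proof.
apply: eq_bigr => b _; rewrite ipE !mxE; apply: eq_bigr => a _.
by rewrite !mxE.
Qed.

Section Geometry.
(* curl holds for every multiple of a curl-free field; meanH is the translator equation, as the
   mean curvature is - tr N. *)
Variable l : 'cV[F]_m.
Hypothesis N_nu : N *m nu = 0.
Hypothesis curl : N - N^T = l *m nu^T - nu *m l^T.
Hypothesis meanH : \tr N = - ip T nu.

(** Contracting curl with nu determines l up to a multiple of nu, and that multiple drops out. *)
Lemma curl_accel : N - N^T = nu *m κ^T - κ *m nu^T.
Proof.
have El : κ = ip l nu *: nu - l.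
  rewrite /accel; have -> : N^T = N - (l *m nu^T - nu *m l^T) by rewrite -curl subKr.
  by rewrite !mulmxBl N_nu !mulmx_outer nu_unit scale1r sub0r opprB.
move: (ip l nu) El => c El; rewrite curl.
have {El} -> : l = c *: nu - κ by rewrite El subKr.
move: κ => k.
by apply/matrixP => a b; rewrite !mxE !big_ord1 !mxE; ring.
Qed.

Lemma shapeE : A = N - nu *m κ^T.
Proof. by rewrite -tproj_dnu tproj_mul trmx_mul trmxK. Qed.

Lemma dnuE : N = A + nu *m κ^T.
Proof. by rewrite shapeE subrK. Qed.

Lemma shape_tr : A^T = A.
Proof.
rewrite shapeE linearB /= trmx_mul trmxK.
have -> : N^T = N - (nu *m κ^T - κ *m nu^T) by rewrite -curl_accel subKr.
by apply/matrixP => a b; rewrite !mxE; ring.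
Qed.

Lemma shape_nu : A *m nu = 0.
Proof. by rewrite -tproj_dnu -mulmxA N_nu mulmx0. Qed.

Lemma tproj_shape : P *m A = A.
Proof. by rewrite -tproj_dnu mulmxA tproj_idem. Qed.

Lemma shape_tproj : A *m P = A.
Proof. by rewrite -{1}shape_tr -{1}tproj_tr -trmx_mul tproj_shape shape_tr. Qed.

Lemma shape_dnu : A *m N = A *m A.
Proof. by rewrite {1}dnuE mulmxDr mulmxA shape_nu mul0mx addr0. Qed.

Lemma accel_nu : ip κ nu = 0.
Proof. by rewrite ipC /accel ip_mulmx trmxK N_nu ip0l. Qed.

Definition normA2 : F := \tr (A *m A).
Local Notation Q := normA2.

Lemma sum_nu_hess : \sum_b nu b 0 *: hess (nu b 0) = - (N *m N^T).
Proof.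
apply/matrixP => a c; rewrite summxE [RHS]mxE [in RHS]mxE.
have : D a ((N *m nu) c 0) = 0 by rewrite N_nu mxE der0.
rewrite mxE der_sum => E; apply/eqP; rewrite -addr_eq0 -big_split /= -[X in _ == X]E.
by apply/eqP/eq_bigr => b _; rewrite !mxE derM; ring.
Qed.

Lemma hess_nu b : hess (nu b 0) =
  map_mx (D b) N + grad (κ b 0) *m nu^T + κ b 0 *: N
  - nu b 0 *: \matrix_(a, c) D a (κ c 0) - col b N *m κ^T.
Proof.
move: curl_accel; move: κ => k curlk; apply/matrixP => a c.
have E : D c (nu b 0) = D b (nu c 0) + (nu c 0 * k b 0 - k c 0 * nu b 0).
  have := congr1 (fun M : 'M[F]_m => M c b) curlk; rewrite /= !mxE !big_ord1 !mxE.
  by move=> <-; ring.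
rewrite !mxE !big_ord1 !mxE E !(derD, derN, derM) (derC _ a b) !ord1.
by ring.
Qed.

(** Differentiating the translator equation, and exchanging the indices of the derivative of nu
    by curl_accel, shows that L nu is a multiple of nu. The factor is found by pairing with nu,
    because <nu, nu> is constant. *)
Lemma dlap_nu b : L (nu b 0) = - Q * nu b 0.
Proof.
pose K := \matrix_(a, c) D a (κ c 0).
(* the factor as it comes out of the computation *)
pose lam := ip κ κ - ip κ T - \tr (P *m K).
have trPN : \tr (P *m N) = - ip T nu.
  rewrite tproj_mul mxtraceB mxtrace_mulC -mulmxA N_nu mulmx0.
  by rewrite mxtrace0 subr0.
have E c x : (row c N *m x) 0 0 = (N *m x) c 0 by rewrite -row_mul mxE.
have trPdN c : \tr (P *m map_mx (D c) N) = (N *m (κ - T)) c 0.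
  have : D c (\tr (P *m N)) = - (N *m T) c 0.
    rewrite trPN derN /ip der_mxtrace der_mulmx -map_trmx T_const trmx0 mul0mx.
    rewrite add0r map_nu -mxtrace_tr trmx_mul !trmxK.
    by rewrite /mxtrace big_ord1 E.
  rewrite der_mxtrace der_mulmx mxtraceD der_tproj mulNmx mxtraceN mulmxDl mxtraceD.
  have -> : \tr ((row c N)^T *m nu^T *m N) = (N *m κ) c 0.
    rewrite -mulmxA mxtrace_mulC -mxtrace_tr !trmx_mul !trmxK mulmxA.
    by rewrite /mxtrace big_ord1 -/κ -mulmxA E.
  rewrite -mulmxA mxtrace_mulC -mulmxA N_nu mulmx0 mxtrace0 addr0 mulmxBr.
  by move: (N *m κ) (N *m T) => x y; rewrite !mxE => h; rewrite -h; ring.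
have Llam c : L (nu c 0) = lam * nu c 0.
  rewrite /L hess_nu -/K.
  rewrite !(mulmxBr, mulmxDr) !(mxtraceB, mxtraceD) -!scalemxAr !mxtraceZ !mulmxA.
  rewrite !trace_outer trPdN trPN.
  have -> : ip nu (P *m grad (κ c 0)) = 0.
    by rewrite ip_mulmx tproj_tr tproj_nu ip0l.
  have colE x : ip (col c N) x = (N^T *m x) c 0.
    by rewrite ipE mxE; apply: eq_bigr => a _; rewrite !mxE.
  have -> : ip κ (P *m col c N) = (N^T *m κ) c 0.
    by rewrite ip_mulmx tproj_tr tprojE ipC ipDr ipNr ipZr [ip nu κ]ipC accel_nu
      mul0r subr0 colE.
  rewrite -dnu_col [ip T (col _ _)]ipC colE /lam.
  move: (\tr (P *m K)) => p.
  have := congr1 (fun v : 'cV_m => v c 0) (congr1 (mulmx^~ (κ - T)) curl_accel).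
  rewrite /= !mulmxBl !mulmx_outer !mulmxBr !ipDr !ipNr [ip nu κ]ipC accel_nu.
  move: (N *m κ) (N *m T) (N^T *m κ) (N^T *m T) => x y z t.
  rewrite [ip nu T]ipC; move: κ => k; rewrite !mxE => h.
  rewrite (_ : x c 0 = z c 0 + (y c 0 - t c 0)
    + ((ip k k - ip k T) * nu c 0 - (0 - ip T nu) * k c 0)); first by ring.
  by rewrite -h; ring.
suff -> : - Q = lam by [].
transitivity (\sum_c nu c 0 * L (nu c 0)); last first.
  rewrite (eq_bigr (fun c => lam * (nu c 0 * nu c 0))) => [|c _].
    by rewrite -mulr_sumr -ipE nu_unit mulr1.
  by rewrite Llam; ring.
transitivity (\tr (P *m \sum_c nu c 0 *: hess (nu c 0))
   + ip T (\sum_c nu c 0 *: grad (nu c 0))); last first.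
  rewrite mulmx_sumr raddf_sum ip_sumr -big_split /=; apply: eq_bigr => c _.
  by rewrite -scalemxAr mxtraceZ ipZr -mulrDr.
have -> : \sum_c nu c 0 *: grad (nu c 0) = 0.
  transitivity (N *m nu) => //; apply/colP => a; rewrite summxE mxE; apply: eq_bigr => c _.
  by rewrite !mxE mulrC.
rewrite sum_nu_hess ip0r addr0 mulmxN mxtraceN /Q; congr (- _).
rewrite -{2}shape_tr -{2}tproj_dnu trmx_mul tproj_tr mulmxA mxtrace_mulC mulmxA tproj_shape.
by rewrite -tproj_dnu !mulmxA.
Qed.

Lemma sum_cdc_nu f : \sum_b nu b 0 * Γ f (nu b 0) = 0.
Proof.
transitivity (ip (P *m grad f) (N *m nu)); last by rewrite N_nu ip0r.
have -> : N *m nu = \sum_b nu b 0 *: grad (nu b 0).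
  apply/colP => a; rewrite summxE mxE; apply: eq_bigr => c _.
  by rewrite !mxE mulrC.
by rewrite ip_sumr; apply: eq_bigr => b _; rewrite ipZr /Γ ip_mulmx tproj_tr.
Qed.

Lemma normA2E : Q = \sum_b Γ (nu b 0) (nu b 0).
Proof.
rewrite /Q -{1}shape_tr -{1}tproj_dnu trmx_mul tproj_tr -mulmxA tproj_shape -tproj_dnu trace_cols.
apply: eq_bigr => b _; rewrite dnu_col /cdc; congr ip.
by rewrite -dnu_col; apply/colP => a; rewrite !mxE; apply: eq_bigr => c _; rewrite !mxE.
Qed.

Lemma sum_cdc_nu0 f : \sum_b nu b 0 * Γ (nu b 0) f = 0.
Proof. by rewrite -[RHS](sum_cdc_nu f); apply: eq_bigr => b _; rewrite cdcC. Qed.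

(** The Hessian of f for the Levi-Civita connection of the graph; the correction stems from the
    normal derivative of f. *)
Definition cov_hess f : 'M[F]_m := P *m hess f *m P - ip nu (grad f) *: A.
Local Notation Y := cov_hess.

Lemma tproj_grad_cdc f : P *m grad (Γ f f) = 2 *: (Y f *m grad f).
Proof.
have -> : Γ f f = \sum_a D a f * D a f - ip nu (grad f) * ip nu (grad f).
  rewrite /Γ tprojE ipDr ipNr ipZr [ip (grad f) nu]ipC; congr (_ - _).
  by rewrite ipE; apply: eq_bigr => a _; rewrite !mxE.
have Gc : grad (ip nu (grad f)) = N *m grad f + hess f *m nu.
  apply/colP => a; rewrite !mxE ipE der_sum -big_split; apply: eq_bigr => b _ /=.
  by rewrite !mxE derM; ring.
have Gs : grad (\sum_a D a f * D a f) = 2 *: (hess f *m grad f).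
  apply/colP => a; rewrite !mxE der_sum mulr_sumr; apply: eq_bigr => b _.
  by rewrite !mxE derM; ring.
rewrite gradD gradN gradM Gs Gc /Y -tproj_dnu mulmxBl -scalemxAl -!mulmxA (tprojE (grad f)).
move: (ip nu _) => c.
rewrite !(mulmxBr, mulmxDr, mulmxN) -?scalemxAr !(mulmxBr, mulmxDr) -?scalemxAr.
by rewrite !mulmxA; apply/colP => a; rewrite !mxE; ring.
Qed.

(** By the Gauss equation the Ricci curvature of the graph is H A - A^2, up to the sign convention
    for A, and for a translator its first term is cancelled by the Hessian of the height
    <x, T>; so - |A Df|^2 is the only curvature term. The computation starts from
    Γ(f, f) = |Df|^2 - <nu, Df>^2. *)
Lemma bochner_formula f : L (Γ f f) =
  2 * (Γ f (L f) + \tr (Y f *m Y f) - ip (A *m grad f) (A *m grad f)).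
Proof.
set c := ip nu (grad f).
have -> : Γ f f = \sum_a D a f * D a f - c * c.
  rewrite /Γ tprojE ipDr ipNr ipZr [ip (grad f) nu]ipC; congr (_ - _).
  by rewrite ipE; apply: eq_bigr => a _; rewrite !mxE.
have Gc : grad c = N *m grad f + hess f *m nu.
  apply/colP => a; rewrite !mxE /c ipE der_sum -big_split; apply: eq_bigr => b _ /=.
  by rewrite !mxE derM; ring.
pose M := hess f; pose v := grad f; pose V := \col_a L (D a f).
have MT : M^T = M by exact: hess_tr.
have EV : V = grad (L f) + 2 *: (N *m M *m nu) by exact: dlap_grad.
have S2 : L (\sum_a D a f * D a f) = 2 * (ip v V + \tr (M *m P *m M)).
  rewrite dlap_sum -{1}MT -mulmxA trace_cols ipE -big_split mulr_sumr.
  apply: eq_bigr => a _; rewrite dlapM !mxE.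
  have -> : Γ (D a f) (D a f) = ip (col a M) (col a (P *m M)).
    have -> : col a (P *m M) = P *m col a M.
      by apply/colP => b; rewrite !mxE; apply: eq_bigr => d _; rewrite !mxE.
    by rewrite /Γ; congr ip; last congr mulmx; apply/colP => b; rewrite !mxE.
  by rewrite /=; ring.
have Sc : L c = - Q * c + ip nu V + 2 * \tr (A *m M).
  have -> : \tr (A *m M) = \sum_a Γ (nu a 0) (D a f).
    rewrite -{1}shape_tr -{1}tproj_dnu trmx_mul tproj_tr -mulmxA trace_cols.
    apply: eq_bigr => a _; rewrite dnu_col /Γ; congr ip.
    by apply/colP => b; rewrite !mxE; apply: eq_bigr => d _; rewrite !mxE.
  rewrite /c ipE dlap_sum ipE !mulr_sumr -!big_split; apply: eq_bigr => a _ /=.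
  by rewrite !mxE dlapM dlap_nu; ring.
rewrite dlapD S2 dlapN dlapM Sc EV /Γ Gc -/v -/M.
(* w is the normal part of the Hessian, which disappears from the final formula *)
rewrite -(mulmxA N); set w := M *m nu; set g := grad (L f).
have projip x y : ip x (P *m y) = ip (P *m x) y by rewrite ip_mulmx tproj_tr.
have cE : ip v nu = c by rewrite ipC.
have h1 : ip (N *m v + w) (P *m (N *m v + w)) =
    ip (A *m v) (A *m v) + 2 * ip (A *m v) w + ip w (P *m w).
  rewrite mulmxDr ipDl !ipDr (projip (N *m v) w) mulmxA tproj_dnu.
  rewrite [ip w (A *m v)]ipC -{1}tproj_shape -mulmxA projip mulmxA tproj_dnu.
  by ring.
have h2 : \tr (Y f *m Y f) =
    \tr (M *m P *m M) - ip w (P *m w) - 2 * (c * \tr (A *m M)) + c * c * Q.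
  rewrite /Y -/c -/M mulmxBl !mulmxBr !mxtraceB -!scalemxAl -!scalemxAr !mxtraceZ.
  rewrite -/Q.
  have -> : \tr (P *m M *m P *m A) = \tr (A *m M).
    by rewrite -mulmxA tproj_shape mxtrace_mulC mulmxA shape_tproj.
  have -> : \tr (A *m (P *m M *m P)) = \tr (A *m M).
    by rewrite !mulmxA shape_tproj mxtrace_mulC mulmxA tproj_shape.
  have -> : \tr (P *m M *m P *m (P *m M *m P)) = \tr (M *m P *m M) - ip w (P *m w).
    rewrite -!mulmxA mxtrace_mulC -!mulmxA tproj_idem.
    have -> : M *m (P *m (P *m (M *m P))) = M *m P *m M - M *m P *m w *m nu^T.
      have MP : M *m P = M - w *m nu^T by rewrite tproj_def mulmxBr mulmx1 mulmxA.
      by rewrite (mulmxA P P) tproj_idem {1}MP !mulmxBr !mulmxA.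
    rewrite mxtraceB trace_outer mulmxA; congr (_ - _).
    by rewrite -mulmxA [LHS]ip_mulmx MT.
  by ring.
have h3 : ip v (N *m w) - c * ip nu (N *m w) = ip (A *m v) w.
  by rewrite -ipZl -ipNl -ipDl -/(v - _) -tprojE -projip mulmxA tproj_dnu ip_mulmx shape_tr.
have h4 : ip v (P *m g) = ip v g - c * ip nu g.
  by rewrite tprojE ipDr ipNr ipZr cE; ring.
rewrite h1 h2 h4 !(ipDr, ipZr) -h3.
by ring.
Qed.

Lemma cov_hess_tr f : (Y f)^T = Y f.
Proof.
rewrite /Y linearB linearZ /= shape_tr.
by rewrite !trmx_mul tproj_tr hess_tr mulmxA.
Qed.

(** Differentiating <nu, nu> = 1 twice: the normal component of the Hessian of nu
    is - A^2. *)
Lemma sum_nu_cov_hess : \sum_b nu b 0 *: Y (nu b 0) = - (A *m A).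
Proof.
rewrite /Y; under eq_bigr do rewrite scalerBr scalemxAl scalemxAr scalerA.
rewrite sumrB -mulmx_suml -mulmx_sumr sum_nu_hess -scaler_suml.
have -> : \sum_b nu b 0 * ip nu (grad (nu b 0)) = 0.
  rewrite -[RHS]accel_nu ipE; apply: eq_bigr => b _; rewrite mulrC; congr (_ * _).
  by rewrite -dnu_col ipE mxE; apply: eq_bigr => a _; rewrite !mxE mulrC.
rewrite scale0r subr0 mulmxN mulNmx; congr (- _).
have -> : A *m A = A *m A^T by rewrite shape_tr.
by rewrite -tproj_dnu trmx_mul tproj_tr !mulmxA.
Qed.

(** Component b of the covariant derivative of A: by sum_nu_cov_hess the added term removes from
    the Hessian of nu its normal component. *)
Definition cov_shape b : 'M[F]_m := Y (nu b 0) + nu b 0 *: (A *m A).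
Local Notation X := cov_shape.

Lemma cov_shape_tr b : (X b)^T = X b.
Proof. by rewrite /X linearD linearZ /= cov_hess_tr trmx_mul shape_tr. Qed.

Lemma cov_shape_tproj b : X b *m P = X b.
Proof.
rewrite /X /Y mulmxDl mulmxBl -!scalemxAl -!mulmxA shape_tproj.
by rewrite tproj_idem.
Qed.

Lemma sum_shape_grad_nu : \sum_b ip (A *m grad (nu b 0)) (A *m grad (nu b 0)) =
  \tr (A *m A *m (A *m A)).
Proof.
have -> : A *m A *m (A *m A) = (A *m N)^T *m (A *m N).
  by rewrite shape_dnu trmx_mul !shape_tr.
rewrite trace_cols; apply: eq_bigr => b _.
have -> // : col b (A *m N) = A *m grad (nu b 0).
by rewrite -dnu_col; apply/colP => a; rewrite !mxE; apply: eq_bigr => c _; rewrite !mxE.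
Qed.

(** Simons' identity, L |A|^2 = 2 |DA|^2 - 2 |A|^4. The Bochner formula for the components of nu is
    summed; the curvature terms add up to - |A^2|^2, which the normal components of the Hessians
    of nu cancel. *)
Lemma simons : L Q = 2 * (\sum_b \tr (X b *m X b) - Q * Q).
Proof.
rewrite {1}normA2E dlap_sum.
under eq_bigr do rewrite bochner_formula dlap_nu cdcMr.
rewrite -mulr_sumr sumrB sum_shape_grad_nu big_split big_split /= sum_cdc_nu0.
rewrite -mulr_sumr -normA2E.
have XX b : \tr (X b *m X b) = \tr (Y (nu b 0) *m Y (nu b 0)) +
    (2 * \tr (nu b 0 *: Y (nu b 0) *m (A *m A)) +
     nu b 0 * nu b 0 * \tr (A *m A *m (A *m A))).
  rewrite /X; move: (Y _) => y; move: (A *m A) (nu b 0) => B c.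
  rewrite mulmxDl !mulmxDr !mxtraceD -!scalemxAl -!scalemxAr !mxtraceZ.
  by rewrite (mxtrace_mulC B y); ring.
rewrite (eq_bigr _ (fun b _ => XX b)) !big_split /= -mulr_suml -ipE nu_unit.
rewrite -mulr_sumr -(mxtrace_sum _ (fun b => nu b 0 *: Y (nu b 0) *m (A *m A))).
rewrite -mulmx_suml sum_nu_cov_hess mulNmx mxtraceN.
by ring.
Qed.

Lemma tproj_grad_normA2 :
  P *m grad Q = 2 *: \sum_b X b *m grad (nu b 0).
Proof.
rewrite normA2E grad_sum mulmx_sumr.
under eq_bigr do rewrite tproj_grad_cdc.
rewrite -scaler_sumr; congr (_ *: _).
under [RHS]eq_bigr do rewrite /X mulmxDl -scalemxAl.
rewrite big_split /=; under [X in _ + X]eq_bigr do rewrite scalemxAr.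
rewrite -mulmx_sumr; have -> : \sum_b nu b 0 *: grad (nu b 0) = N *m nu.
  apply/colP => a; rewrite summxE mxE; apply: eq_bigr => c _.
  by rewrite !mxE mulrC.
by rewrite N_nu mulmx0 addr0.
Qed.

Section HeightFunction.
Variables (e : 'I_m) (W : F).
Hypothesis W_inv : W * nu e 0 = 1.
Local Notation s := (nu e 0).

Lemma cdc1 f : Γ f 1 = 0.
Proof.
rewrite /Γ; have -> : grad 1 = 0 by apply/colP => a; rewrite !mxE der1.
by rewrite mulmx0 ip0r.
Qed.

Lemma dlap1 : L 1 = 0.
Proof.
rewrite /L; have -> : grad 1 = 0 by apply/colP => a; rewrite !mxE der1.
have -> : hess 1 = 0 by apply/matrixP => a b; rewrite !mxE der1 der0.
by rewrite mulmx0 mxtrace0 ip0r addr0.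
Qed.

Lemma cdc_W_inv f : Γ f s = - (s * s * Γ f W).
Proof.
have := cdc1 f; rewrite -W_inv cdcMr => E.
transitivity (W * s * Γ f s); first by rewrite W_inv mul1r.
by apply/eqP; rewrite -addr_eq0; apply/eqP; rewrite -[RHS](mulr0 s) -E; ring.
Qed.

Lemma dlap_W : L W = W * Q + 2 * s * Γ W W.
Proof.
have := dlap1; rewrite -W_inv dlapM dlap_nu cdc_W_inv => E.
transitivity (W * (s * L W)); first by rewrite mulrA W_inv mul1r.
have -> : s * L W = W * s * Q + 2 * s * s * Γ W W.
  by apply/eqP; rewrite -subr_eq0; apply/eqP; rewrite -[RHS]E; ring.
transitivity (W * s * (W * Q + 2 * s * Γ W W)); first by ring.
by rewrite W_inv mul1r.
Qed.

Lemma dlap_W2 : L (W * W) = 2 * W * W * Q + 6 * Γ W W.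
Proof.
rewrite dlapM dlap_W; transitivity (2 * W * W * Q + (2 + 4 * (W * s)) * Γ W W).
  by ring.
by rewrite W_inv; ring.
Qed.

(** Everything in dlap_W2Q that contains derivatives of A or of W, completed to a sum of squares. *)
Definition simons_square : F :=
  \sum_b \sum_a \sum_c
    (W * X b a c + (P *m grad W) a 0 * A c b) ^+ 2.

Lemma simons_squareE : simons_square =
  W * W * (\sum_b \tr (X b *m X b)) + W * Γ W Q + Q * Γ W W.
Proof.
pose z := P *m grad W.
pose E b := W *: X b + z *m (col b A)^T.
have -> : simons_square = \sum_b \tr ((E b)^T *m E b).
  apply: eq_bigr => b _; rewrite exchange_big; apply: eq_bigr => c _.
  rewrite mxE; apply: eq_bigr => a _; rewrite /E -/z; move: (X b) => x.
  by rewrite !mxE !big_ord1 !mxE expr2.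
have EE b : \tr ((E b)^T *m E b) = W * W * \tr (X b *m X b)
    + W * (2 * ip (X b *m grad (nu b 0)) z) + ip (col b A) (col b A) * ip z z.
  have -> : X b *m grad (nu b 0) = X b *m col b A.
    rewrite -{1}cov_shape_tproj -mulmxA -dnu_col; congr (_ *m _).
    by rewrite -tproj_dnu; apply/colP => a; rewrite !mxE; apply: eq_bigr => c _; rewrite !mxE.
  by rewrite trace_add_outer ?cov_shape_tr.
have EG : 2 * \sum_b ip (X b *m grad (nu b 0)) z = Γ W Q.
  under eq_bigr do rewrite ipC.
  rewrite -ip_sumr -ipZr -tproj_grad_normA2 /z /Γ !ip_mulmx !tproj_tr.
  by rewrite mulmxA tproj_idem.
rewrite (eq_bigr _ (fun b _ => EE b)) !big_split /= -!mulr_sumr -mulr_suml EG.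
by rewrite -trace_cols shape_tr -/Q /z -cdc_sq.
Qed.

(** As s = 1/W, the first term on the right is 2 Γ(log W, g) for g = |A|^2 W^2. The negative term of
    Simons' identity is absorbed exactly by L W = W |A|^2 + 2 Γ(W, W)/W. *)
Lemma dlap_W2Q : L (W * W * Q) = 2 * s * Γ W (W * W * Q) + 2 * simons_square.
Proof.
rewrite simons_squareE dlapM simons dlap_W2 cdcMl !cdcMr.
move: (\sum_b _) => x.
transitivity (2 * W * W * x + 6 * Q * Γ W W + 4 * W * Γ W Q); first by ring.
transitivity ((2 + 4 * (W * s)) * Q * Γ W W + (2 + 2 * (W * s)) * W * Γ W Q
  + 2 * W * W * x); last by ring.
by rewrite W_inv; ring.
Qed.
End HeightFunction.
End Geometry.
End Operator.
End Derivations.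

(** * The differential ring of smooth functions *)

Section SmoothRing.
Variables (R : realType) (n : nat).
Local Notation V := 'rV[R]_n.

Definition smooth_pred : {pred V -> R} := mem [set f : V -> R | smooth f].

Lemma smooth_predP f : reflect (smooth f) (f \in smooth_pred).
Proof. by apply: (iffP idP) => [/set_mem|sf]; [|apply/mem_set]. Qed.

Lemma smooth_subring_closed : subring_closed smooth_pred.
Proof.
split=> [|f g|f g].
- by apply/smooth_predP; exact: smooth_cst.
- by move=> /smooth_predP sf /smooth_predP sg; apply/smooth_predP/smoothD/smoothN.
- by move=> /smooth_predP sf /smooth_predP sg; apply/smooth_predP/smoothM.
Qed.

HB.instance Definition _ := GRing.isSubringClosed.Build (V -> R) smooth_pred
  smooth_subring_closed.

Record smooth_fun := SmoothFun { smooth_val :> V -> R; _ : smooth_val \in smooth_pred }.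
HB.instance Definition _ := [isSub for smooth_val].
HB.instance Definition _ := [Choice of smooth_fun by <:].
HB.instance Definition _ := [SubChoice_isSubComNzRing of smooth_fun by <:].

Lemma smooth_funP (f : smooth_fun) : smooth f.
Proof. by case: f => f sf; apply/smooth_predP. Qed.

Definition mk_smooth (f : V -> R) (sf : smooth f) : smooth_fun :=
  SmoothFun (introT (smooth_predP f) sf).

Lemma smooth_fun_eq (f g : smooth_fun) : f =1 g -> f = g.
Proof. by move=> fg; apply: val_inj; apply/funext. Qed.

(** Evaluation at a point, through which identities of the ring become identities of reals. *)
Definition ev (x : V) (f : smooth_fun) : R := f x.
Lemma ev_additive x : zmod_morphism (ev x).
Proof. by []. Qed.
Lemma ev_multiplicative x : monoid_morphism (ev x).
Proof. by []. Qed.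
HB.instance Definition _ x := GRing.isZmodMorphism.Build smooth_fun R (ev x) (ev_additive x).
HB.instance Definition _ x := GRing.isMonoidMorphism.Build smooth_fun R (ev x) (ev_multiplicative x).

Definition spartial (i : 'I_n) (f : smooth_fun) : smooth_fun :=
  mk_smooth (smooth_partial i (smooth_funP f)).

(** Functions on R^n extend to R^(n+1) independently of the height, so the last derivation is 0. *)
Definition sder (a : 'I_(n + 1)) (f : smooth_fun) : smooth_fun :=
  if fintype.split a is inl i then spartial i f else 0.

Lemma sder_l i f : sder (lshift 1 i) f = spartial i f.
Proof. by rewrite /sder -[lshift 1 i]/(unsplit (inl i)) unsplitK. Qed.
Lemma sder_r k f : sder (rshift n k) f = 0.
Proof. by rewrite /sder -[rshift n k]/(unsplit (inr k)) unsplitK. Qed.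

Lemma sderD a f h : sder a (f + h) = sder a f + sder a h.
Proof.
rewrite /sder; case: fintype.split => [i|_]; last by rewrite addr0.
apply: val_inj; exact: (partialD i (smooth_funP f) (smooth_funP h)).
Qed.
Lemma sderM a f h : sder a (f * h) = sder a f * h + f * sder a h.
Proof.
rewrite /sder; case: fintype.split => [i|_]; last by rewrite mulr0 mul0r addr0.
apply: val_inj; exact: (partialM i (smooth_funP f) (smooth_funP h)).
Qed.
Lemma sder0 a : sder a 0 = 0.
Proof. by apply: (addrI (sder a 0)); rewrite -sderD !addr0. Qed.
Lemma spartial0 i : spartial i 0 = 0.
Proof. by rewrite -sder_l sder0. Qed.
Lemma sderC a b f : sder a (sder b f) = sder b (sder a f).
Proof.
rewrite -(splitK a) -(splitK b).
case: (fintype.split a) => i; case: (fintype.split b) => j /=;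
  rewrite ?sder_l ?sder_r ?sder0 ?sder_l ?sder_r ?spartial0 //.
by apply: val_inj; exact: (partialC i j (smooth_funP f)).
Qed.
Definition smooth_der : derivations smooth_fun (n + 1) := Derivations sderD sderM sderC.

Definition scst (c : R) : smooth_fun := mk_smooth (@smooth_cst R n c).
Lemma sder_cst a c : sder a (scst c) = 0.
Proof.
rewrite /sder; case: fintype.split => // i; apply: val_inj => /=.
exact: partial_cst.
Qed.
Definition scoord (i : 'I_n) : smooth_fun := mk_smooth (@smooth_coord R n i).
Lemma sder_coord i j : sder (lshift 1 j) (scoord i) = (i == j)%:R.
Proof.
rewrite sder_l; apply: smooth_fun_eq => x /=.
have [_ E] := coord_is_derive i j x; rewrite [LHS]E.
by case: (i == j).
Qed.

Lemma hess_nonpos (f : smooth_fun) x (v : 'I_(n + 1) -> R) :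
  (\forall y \near x, f y <= f x) ->
  \sum_a v a * \sum_b v b * ev x (smooth_der b (smooth_der a f)) <= 0.
Proof.
move=> fmax; have [_ H] := local_max_test (smooth_funP f) fmax.
have := H (\row_i v (lshift 1 i)); rewrite big_split_ord /= [X in _ + X]big1 ?addr0; last first.
  move=> i _; rewrite big1 ?mulr0 // => b _.
  by rewrite sder_r sder0 rmorph0 mulr0.
move=> h; apply: le_trans h; rewrite le_eqVlt; apply/orP; left; apply/eqP.
apply: eq_bigr => i _; rewrite mxE; congr (_ * _).
rewrite big_split_ord /= [X in _ + X]big1 ?addr0 => [|k _].
  by apply: eq_bigr => j _; rewrite mxE !sder_l.
by rewrite sder_r rmorph0 mulr0.
Qed.

Lemma grad_max (f : smooth_fun) x a : (\forall y \near x, f y <= f x) ->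
  ev x (smooth_der a f) = 0.
Proof.
move=> fmax; have [H _] := local_max_test (smooth_funP f) fmax.
rewrite -(splitK a); case: (fintype.split a) => i /=; rewrite ?sder_l ?sder_r ?rmorph0 //.
exact: H.
Qed.
End SmoothRing.

(** * First and second order conditions at a point *)

Section Pointwise.
Variables (R : realType) (n : nat).
Local Notation V := 'rV[R]_n.
Local Notation S := (smooth_fun R n).
Local Notation D := (smooth_der R n).
Variables (nu T : 'cV[S]_(n + 1)).
Hypothesis nu_unit : ip nu nu = 1.
Local Notation P := (tproj nu).
Local Notation Γ := (cdc D nu).
Local Notation L := (dlap D nu T).
Implicit Types (f h : S) (x : V).

Lemma evD x f h : ev x (f + h) = ev x f + ev x h. Proof. by []. Qed.
Lemma evM x f h : ev x (f * h) = ev x f * ev x h. Proof. by []. Qed.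
Lemma evN x f : ev x (- f) = - ev x f. Proof. by []. Qed.

Lemma ev_ip_sq x (v : 'cV[S]_(n + 1)) : ev x (ip v v) = \sum_a ev x (v a 0) ^+ 2.
Proof. by rewrite ipE rmorph_sum; apply: eq_bigr => a _; rewrite expr2. Qed.

Lemma cdc_ge0 x f : 0 <= ev x (Γ f f).
Proof.
by rewrite (cdc_sq D nu_unit) ev_ip_sq; apply: sumr_ge0 => a _; exact: sqr_ge0.
Qed.

Lemma cdc_le x f : ev x (Γ f f) <= \sum_a ev x (D a f) ^+ 2.
Proof.
rewrite /cdc tprojE ipDr ipNr ipZr [ip (grad D f) nu]ipC.
rewrite evD evN evM ev_ip_sq.
under eq_bigr do rewrite mxE.
by rewrite -[X in _ <= X]subr0 lerD2l lerN2 -expr2 sqr_ge0.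
Qed.

Lemma tproj_diag_le1 x a : ev x (P a a) <= 1.
Proof.
rewrite tproj_def !mxE eqxx big_ord1 !mxE.
by rewrite evD evN evM gerBl -expr2 sqr_ge0.
Qed.

(** As P = P P^T, the second order part of L f sums second derivatives along the columns of P. *)
Lemma dlap_max x f : (\forall y \near x, f y <= f x) -> ev x (L f) <= 0.
Proof.
move=> fmax; have g0 a : ev x (D a f) = 0 by exact: grad_max.
have E : ev x (ip T (grad D f)) = 0.
  by rewrite ipE rmorph_sum big1 // => a _; rewrite mxE rmorphM /= g0 mulr0.
rewrite /dlap evD E addr0.
have -> : \tr (P *m hess D f) = \tr (P *m hess D f *m P).
  by rewrite [RHS]mxtrace_mulC mulmxA (tproj_idem nu_unit).
rewrite /mxtrace rmorph_sum; apply: sumr_le0 => c _.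
apply: le_trans (hess_nonpos (fun a => ev x (P a c)) fmax).
rewrite le_eqVlt; apply/orP; left; apply/eqP.
rewrite mxE rmorph_sum.
under eq_bigr do rewrite mxE mulr_suml rmorph_sum.
rewrite exchange_big /=; apply: eq_bigr => a _; rewrite mulr_sumr.
apply: eq_bigr => b _.
have PT : P c a = P a c by rewrite -{1}(tproj_tr nu) mxE.
have HT : hess D f a b = sder b (sder a f) by rewrite mxE; exact: sderC.
rewrite PT HT -[LHS]/(ev x (P a c) * ev x (sder b (sder a f)) * ev x (P b c)).
by rewrite -mulrA; congr (_ * _); exact: mulrC.
Qed.

(** The Cauchy-Schwarz inequality for Γ, as a quadratic in t to avoid square roots. *)
Lemma cdc_quad_ge0 x f h (t : R) :
  0 <= t ^+ 2 * ev x (Γ f f) + 2 * t * ev x (Γ f h) + ev x (Γ h h).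
Proof.
have -> : t ^+ 2 * ev x (Γ f f) + 2 * t * ev x (Γ f h) + ev x (Γ h h) =
    ev x (Γ (scst n t * f + h) (scst n t * f + h)).
  rewrite cdc_quad; last by apply/colP => a; rewrite !mxE; exact: sder_cst.
  by rewrite expr2.
exact: cdc_ge0.
Qed.
End Pointwise.

(** * The normal field of a graphical translator *)

Section Translator.
Variables (R : realType) (n : nat) (u : 'rV[R]_n -> R) (T : 'rV[R]_(n + 1)).
Hypothesis u_smooth : smooth u.
Local Notation V := 'rV[R]_n.
Local Notation S := (smooth_fun R n).
Local Notation D := (smooth_der R n).

Definition slope (i : 'I_n) : S := spartial i (mk_smooth u_smooth).

Lemma area_sq x : area_factor u x ^+ 2 = 1 + \sum_i partial i u x ^+ 2.
Proof.
have d0 : 0 <= dot (gradient u x) (gradient u x).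
  by apply: sumr_ge0 => i _; rewrite -expr2 sqr_ge0.
rewrite /area_factor /enorm sqr_sqrtr // sqr_sqrtr ?addr_ge0 ?sqr_ge0 //.
by congr (_ + _); apply: eq_bigr => i _; rewrite mxE expr2.
Qed.

Lemma area_gt0 x : 0 < area_factor u x.
Proof. by rewrite sqrtr_gt0 ltr_pwDl // sqr_ge0. Qed.

Lemma smooth_area : smooth (area_factor u).
Proof.
have -> : area_factor u = fun x => Num.sqrt (ev x (1 + \sum_i slope i * slope i)).
  apply/funext => x; rewrite -[LHS]gtr0_norm ?area_gt0 // -sqrtr_sqr area_sq.
  by rewrite evD rmorph_sum; congr (Num.sqrt (_ + _)); apply: eq_bigr => i _; rewrite expr2.
apply: smooth_sqrt; last exact: (smooth_funP (1 + \sum_i slope i * slope i)).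
move=> x; rewrite evD rmorph_sum ltr_pwDl //; apply: sumr_ge0 => i _.
exact: (sqr_ge0 (ev x (slope i))).
Qed.

Definition sarea : S := mk_smooth smooth_area.
Lemma smooth_area_inv : smooth (fun x => (area_factor u x)^-1).
Proof. by apply: smoothV smooth_area => x; rewrite gt_eqF ?area_gt0. Qed.
Definition sareaV : S := mk_smooth smooth_area_inv.

Definition snormal : 'cV[S]_(n + 1) :=
  col_mx (\col_i (- (slope i * sareaV))) (sareaV%:M).
Definition sdir : 'cV[S]_(n + 1) := \col_a scst n (T 0 a).
Local Notation nu := snormal.

Lemma snormal_l i : nu (lshift 1 i) 0 = - (slope i * sareaV).
Proof. by rewrite col_mxEu mxE. Qed.
Lemma snormal_r k : nu (rshift n k) 0 = sareaV.
Proof. by rewrite col_mxEd mxE !ord1 eqxx mulr1n. Qed.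

Lemma sareaVK : sarea * sareaV = 1.
Proof. by apply: smooth_fun_eq => x; apply: mulfV; rewrite gt_eqF ?area_gt0. Qed.

Lemma sarea_sq : sarea * sarea = 1 + \sum_i slope i * slope i.
Proof.
apply: smooth_fun_eq => x; rewrite -[LHS]/(area_factor u x * area_factor u x) -expr2.
by rewrite area_sq -[RHS]/(ev x _) evD rmorph_sum; congr (_ + _).
Qed.

Lemma snormal_unit : ip nu nu = 1.
Proof.
rewrite ipE big_split_ord /= big_ord1 snormal_r.
under eq_bigr do rewrite snormal_l.
transitivity (sareaV * sareaV * (sarea * sarea)).
  rewrite sarea_sq mulrDr mulr1 addrC; congr (_ + _).
  by rewrite mulr_sumr; apply: eq_bigr => i _; ring.
by rewrite mulrACA [sareaV * sarea]mulrC sareaVK mulr1.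
Qed.

Lemma sdir_const a : map_mx (D a) sdir = 0.
Proof. by apply/colP => b; rewrite !mxE; exact: sder_cst. Qed.

Lemma dnu_snormal : dnu D nu *m nu = 0.
Proof.
apply: (dnu_nu D snormal_unit) => f f0; apply: smooth_fun_eq => x.
have := congr1 (ev x) f0; rewrite evM rmorph0 => /eqP.
rewrite -[ev x 2]/(2 : R) mulf_eq0 pnatr_eq0 /= => /eqP E; exact: E.
Qed.

(** nu is 1/W times the gradient of x_(n+1) - u, so only the derivative of 1/W survives
    antisymmetrization. *)
Lemma curl_snormal : let l := sarea *: grad D sareaV in
  dnu D nu - (dnu D nu)^T = l *m nu^T - nu *m l^T.
Proof.
pose q (a : 'I_(n + 1)) : S := if fintype.split a is inl i then - slope i else 1.
have ql i : q (lshift 1 i) = - slope i by rewrite /q (unsplitK (inl i)).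
have qr k : q (rshift n k) = 1 by rewrite /q (unsplitK (inr k)).
have nuE a : nu a 0 = sareaV * q a.
  rewrite -(splitK a); case: (fintype.split a) => k; rewrite [unsplit _]/=.
    by rewrite snormal_l ql; ring.
  by rewrite snormal_r qr mulr1.
have qC a b : D a (q b) = D b (q a).
  rewrite -(splitK a) -(splitK b).
  case: (fintype.split a) => i; case: (fintype.split b) => j; rewrite ![unsplit _]/=.
  - by rewrite !ql !derN; congr (- _); rewrite /slope -!sder_l; exact: sderC.
  - by rewrite ql qr der1 derN [D _ _]sder_r oppr0.
  - by rewrite ql qr der1 derN [D _ _]sder_r oppr0.
  - by rewrite !qr !der1.
have -> : nu = \col_a (sareaV * q a) by apply/colP => a; rewrite [RHS]mxE nuE.
move: sareaV sarea sareaVK => s w ws l.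
apply/matrixP => a b; rewrite !mxE !big_ord1 !mxE !derM (qC a b).
transitivity ((w * s) * (D a s * q b - D b s * q a)).
  by rewrite ws; ring.
by ring.
Qed.

Lemma mean_curvature_snormal : translator u T ->
  \tr (dnu D nu) = - ip sdir nu.
Proof.
move=> tr_u; apply: smooth_fun_eq => x; rewrite -[LHS]/(ev x _) -[RHS]/(ev x _).
transitivity (- mean_curvature u x).
  have -> : \tr (dnu D nu) = \sum_i D (lshift 1 i) (nu (lshift 1 i) 0).
    rewrite /mxtrace big_split_ord /= big_ord1 [X in _ + X]mxE [X in _ + X]sder_r addr0.
    by apply: eq_bigr => i _; rewrite mxE.
  rewrite rmorph_sum -sumrN; apply: eq_bigr => i _; rewrite snormal_l derN.
  by rewrite [D _ _]sder_l.
rewrite tr_u evN ipE rmorph_sum; congr (- _).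
rewrite /dot; apply: eq_bigr => a _.
transitivity (ev x (nu a 0) * T 0 a); last by rewrite [sdir a 0]mxE; exact: mulrC.
congr (_ * _); rewrite /normal mxE -(splitK a).
case: (fintype.split a) => k; rewrite [unsplit _]/=.
  by rewrite snormal_l row_mxEl !mxE mulrN mulrC.
by rewrite snormal_r row_mxEr mxE !ord1 eqxx mulr1.
Qed.
End Translator.

(** * The interior curvature estimate *)

(** What the conditions at a maximum point of eta g / (K - w), with value m, say about
    a = Γ(eta, eta), b = Γ(W, W), G = Γ(eta, W), GgW = Γ(g, W), Gge = Γ(g, eta) and the values Le, Lg, Lw
    of L: the two equations are the vanishing of the gradient, paired with those of W and eta, and
    the inequality is the second order condition. The term 2 m g comes from L w; the terms in G are
    absorbed by 2 eta b / K. *)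
Lemma max_point_arith (R : realType) (m K eta g w W s G GgW Gge a b Le Lg Lw S : R) :
  0 < m -> 0 < eta -> 0 < g -> 1 <= W -> W * s = 1 -> w = W * W -> 2 * w <= K ->
  m * (K - w) = eta * g -> 0 <= a -> 0 <= b -> 0 <= S ->
  (forall t, 0 <= t ^+ 2 * a + 2 * t * G + b) ->
  Lg = 2 * s * GgW + 2 * S -> Lw = 2 * g + 6 * b ->
  eta * GgW + g * G + m * (W * b + W * b) = 0 ->
  eta * Gge + g * a + m * (W * G + W * G) = 0 ->
  eta * Lg + g * Le + 2 * Gge + m * Lw <= 0 ->
  2 * m <= - Le + 7 * K * a / eta.
Proof.
move=> m0 e0 g0 W1 Ws wE wK mK a0 b0 S0 quad -> -> E1 E2 E3.
have s0 : 0 < s by rewrite -(pmulr_rgt0 _ (lt_le_trans ltr01 W1)) Ws.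
have s1 : s <= 1 by rewrite -Ws ler_peMl // ltW.
have w1 : 1 <= w by rewrite wE mulr_ege1.
have K0 : 0 < K by lra.
have mw : m * W <= eta * g * s.
  have -> : m * W = m * w * s by rewrite wE; transitivity (m * W * (W * s)); [rewrite Ws mulr1 | ring].
  by rewrite ler_pM2r // -mK ler_pM2l //; lra.
have mge : eta * g / K <= m.
  by rewrite ler_pdivrMr // -mK ler_pM2l //; lra.
have D1 : 2 * m * g + 2 * m * b <= 2 * s * g * G - g * Le - 2 * Gge.
  have E1' : eta * GgW = - (g * G + 2 * m * W * b) by lra.
  have X : eta * (2 * s * GgW + 2 * S) = - (2 * s * g * G) - 4 * m * b + 2 * eta * S.
    transitivity (2 * s * (eta * GgW) + 2 * eta * S); first by ring.
    rewrite E1'; transitivity (- (2 * s * g * G) - 4 * m * (W * s) * b + 2 * eta * S); first by ring.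
    by rewrite Ws; ring.
  have eS : 0 <= eta * S by rewrite mulr_ge0 // ltW.
  rewrite X in E3; lra.
have aG : G <= `|G| by exact: ler_norm.
have mG : m * W * G <= eta * g * s * `|G|.
  apply: le_trans (ler_wpM2r (normr_ge0 G) mw).
  by rewrite ler_wpM2l // mulr_ge0 ?ltW //; lra.
have sG : s * g * eta * G <= eta * g * s * `|G|.
  have -> : s * g * eta * G = eta * g * s * G by ring.
  by rewrite ler_wpM2l // !mulr_ge0 // ltW.
have mb : eta * (eta * g / K) * b <= eta * m * b.
  by rewrite ler_wpM2r // ler_pM2l.
have D2 : 2 * m * g * eta <= 6 * (eta * g * s * `|G|) - g * Le * eta + 2 * g * a
    - 2 * (eta * (eta * g / K) * b).
  have := D1; rewrite -(ler_pM2r e0) => D.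
  have E2' : eta * Gge = - (g * a + 2 * m * W * G) by lra.
  nra.
have GG : 6 * s * `|G| <= 2 * eta * b / K + 9 / 2 * s ^+ 2 * K * a / eta.
  (* the weight for which the b-term is exactly 2 eta b / K *)
  pose t := 3 * s * K / (2 * eta).
  have t0 : 0 < t by rewrite divr_gt0 // !mulr_gt0.
  have h : 2 * t * `|G| <= t ^+ 2 * a + b.
    have [G0|G0] := leP 0 G.
      by have := quad (- t); rewrite ger0_norm // sqrrN; lra.
    by have := quad t; rewrite ltr0_norm //; lra.
  have -> : 6 * s * `|G| = (3 * s / t) * (2 * t * `|G|).
    by field; rewrite gt_eqF.
  have -> : 2 * eta * b / K + 9 / 2 * s ^+ 2 * K * a / eta = (3 * s / t) * (t ^+ 2 * a + b).
    by rewrite /t; field; rewrite !gt_eqF.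
  by rewrite ler_pM2l // divr_gt0 // mulr_gt0.
have ss : s ^+ 2 <= 1 by rewrite expr_le1 // ltW.
have F : 9 / 2 * s ^+ 2 * K * a / eta + 2 * a / eta <= 7 * K * a / eta.
  rewrite -mulrDl ler_pM2r ?invr_gt0 //.
  have Ka : 0 <= K * a by rewrite mulr_ge0 // ltW.
  have : s ^+ 2 * (K * a) <= K * a by rewrite ler_piMl.
  have : 2 * a <= K * a by rewrite ler_wpM2r //; lra.
  lra.
have D3 : 2 * m <= 6 * s * `|G| - Le + 2 * a / eta - 2 * eta * b / K.
  rewrite -(ler_pM2r (mulr_gt0 g0 e0)).
  apply: le_trans (_ : _ <= _) _; last first.
    apply: le_trans (_ : 6 * (eta * g * s * `|G|) - g * Le * eta + 2 * g * a
    - 2 * (eta * (eta * g / K) * b) <= _); last first.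
      by rewrite le_eqVlt; apply/orP; left; apply/eqP; field; rewrite !gt_eqF.
    exact: D2.
  by rewrite mulrA.
lra.
Qed.

Section MaxPoint.
Variables (R : realType) (n : nat) (nu T : 'cV[smooth_fun R n]_(n + 1)).
Local Notation V := 'rV[R]_n.
Local Notation S := (smooth_fun R n).
Local Notation D := (smooth_der R n).
Local Notation Γ := (cdc D nu).
Local Notation L := (dlap D nu T).
Hypothesis nu_unit : ip nu nu = 1.

Lemma ev_cdc_expand x (m : R) (a b c d e f : S) :
  ev x (a * b + c * d + scst n m * (e * f + e * f)) =
  ev x a * ev x b + ev x c * ev x d + m * (ev x e * ev x f + ev x e * ev x f).
Proof. by []. Qed.

Lemma ev_dlap_expand x (m : R) (a b c d e f : S) :
  ev x (a * b + c * d + 2 * e + scst n m * f) =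
  ev x a * ev x b + ev x c * ev x d + 2 * ev x e + m * ev x f.
Proof. by []. Qed.

(** Instead of the quotient eta g / (K - w) with maximum m one differentiates eta g + m w,
    which is maximal at the same point and has no denominator. *)
Lemma max_point_bound (W s g eta : S) (x : V) (m K q : R) :
  W * s = 1 -> 1 <= ev x W -> 0 <= q ->
  ev x (L g) = 2 * ev x s * ev x (Γ W g) + 2 * q ->
  ev x (L (W * W)) = 2 * ev x g + 6 * ev x (Γ W W) ->
  (\forall y \near x, ev y (eta * g + scst n m * (W * W)) <=
                      ev x (eta * g + scst n m * (W * W))) ->
  0 < m -> 0 < ev x eta -> 0 < ev x g -> 2 * ev x (W * W) <= K ->
  m * (K - ev x (W * W)) = ev x eta * ev x g ->
  2 * m <= - ev x (L eta) + 7 * K * ev x (Γ eta eta) / ev x eta.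
Proof.
move=> Ws W1 q0 Lg Lw Fmax m0 e0 g0 wK mK.
have mc : grad D (scst n m) = 0 by apply/colP => a; rewrite !mxE; exact: sder_cst.
set F := eta * g + scst n m * (W * W) in Fmax.
have gF h : ev x (Γ F h) = 0.
  rewrite /cdc ipE rmorph_sum big1 // => a _.
  have H0 : ev x (grad D F a 0) = 0 by rewrite mxE; exact: grad_max.
  exact: etrans (congr1 (fun r => r * _) H0) (mul0r _).
have LF : ev x (L F) <= 0 by exact: dlap_max.
have FE h : Γ F h = eta * Γ g h + g * Γ eta h + scst n m * (W * Γ W h + W * Γ W h).
  by rewrite /F cdcDl cdcMl (cdcZl _ _ _ mc) (cdcMl _ _ W W).
have LFE : L F = eta * L g + g * L eta + 2 * Γ eta g + scst n m * L (W * W).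
  by rewrite /F dlapD dlapM (dlapZ _ _ _ mc).
apply: (max_point_arith (W := ev x W) (s := ev x s) m0 e0 g0 W1 _ (erefl _)
  wK mK (cdc_ge0 nu_unit x eta) (cdc_ge0 nu_unit x W) q0 (G := ev x (Γ eta W)) _ Lg Lw
  _ (Gge := ev x (Γ g eta)) _).
- by rewrite -evM Ws.
- by move=> t; exact: cdc_quad_ge0.
- by have := gF W; rewrite FE (cdcC _ _ g W) ev_cdc_expand.
- by have := gF eta; rewrite FE (cdcC _ _ W eta) ev_cdc_expand.
- by move: LF; rewrite LFE (cdcC _ _ eta g) ev_dlap_expand.
Qed.
End MaxPoint.

Section Estimate.
Variables (R : realType) (n : nat) (u : 'rV[R]_n -> R) (T : 'rV[R]_(n + 1)).
Hypothesis u_smooth : smooth u.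
Hypothesis tr_u : translator u T.
Local Notation V := 'rV[R]_n.
Local Notation S := (smooth_fun R n).
Local Notation D := (smooth_der R n).
Local Notation nu := (snormal u_smooth).
Local Notation Γ := (cdc D nu).
Local Notation L := (dlap D nu (sdir T)).
Local Notation W := (sarea u_smooth).
Local Notation s := (sareaV u_smooth).
Local Notation Q := (normA2 D nu).
Local Notation g := (W * W * Q).
Implicit Types (x : V).

Let U1 := snormal_unit u_smooth.
Let N0 := dnu_snormal u_smooth.
Let curlN := curl_snormal u_smooth.
Let trN := mean_curvature_snormal u_smooth tr_u.
Let Tc := sdir_const T.

Lemma W_nu : W * nu (rshift n 0) 0 = 1.
Proof. by rewrite snormal_r sareaVK. Qed.

Lemma ev_dlap_g x : exists2 q : R, 0 <= q &
  ev x (L g) = 2 * ev x s * ev x (Γ W g) + 2 * q.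
Proof.
exists (ev x (simons_square D nu W)).
  rewrite /simons_square rmorph_sum; apply: sumr_ge0 => b _.
  rewrite rmorph_sum; apply: sumr_ge0 => a _; rewrite rmorph_sum.
  by apply: sumr_ge0 => c _; rewrite rmorphXn; exact: sqr_ge0.
by rewrite (dlap_W2Q Tc U1 N0 curlN trN W_nu) snormal_r.
Qed.

Lemma ev_dlap_w x : ev x (L (W * W)) = 2 * ev x g + 6 * ev x (Γ W W).
Proof.
rewrite (dlap_W2 Tc U1 N0 curlN trN W_nu).
transitivity (2 * ev x W * ev x W * ev x Q + 6 * ev x (Γ W W)) => //.
by rewrite !evM; ring.
Qed.

Lemma area_ge1 x : 1 <= ev x W.
Proof.
have H : 0 <= \sum_i partial i u x ^+ 2 by apply: sumr_ge0 => i _; exact: sqr_ge0.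
rewrite -(@ler_pXn2r _ 2) ?nnegrE // ?(ltW (area_gt0 u x)) //.
by rewrite [leRHS]area_sq expr1n; lra.
Qed.

End Estimate.

Section WeightedMax.
Variables (R : realType) (n : nat).
Local Notation V := 'rV[R]_n.
Local Notation S := (smooth_fun R n).

(** The quotient cut^2 g / (K - w) vanishes where cut does, so its maximum over the set cut >= 0
    lies in the open set cut > 0; there the maximality becomes a local one. *)
Lemma weighted_max (cut g w : S) (c : V) (K : R) :
  compact [set x | 0 <= ev x cut] -> 0 < ev c cut -> 0 < ev c g ->
  (forall x, 0 <= ev x g) -> (forall x, 0 <= ev x cut -> ev x w < K) ->
  exists x0 m,
  [/\ [/\ 0 < m, 0 < ev x0 cut, 0 < ev x0 g &
       m * (K - ev x0 w) = ev x0 (cut * cut) * ev x0 g],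
     \forall y \near x0, ev y (cut * cut * g + scst n m * w) <=
                         ev x0 (cut * cut * g + scst n m * w) &
     ev c g * ev c (cut * cut) <= m * (K - ev c w)].
Proof.
move=> cB cut_c g_c g0 wK.
have Kw x : 0 <= ev x cut -> 0 < K - ev x w by move=> /wK; rewrite subr_gt0.
pose Phi x := ev x (cut * cut) * ev x g / (K - ev x w).
have cont (f : S) : continuous (fun x => ev x f).
  by apply: smooth_continuous; exact: smooth_funP f.
have Phic : {within [set x | 0 <= ev x cut], continuous Phi}.
  apply: continuous_in_subspaceT => x /set_mem /= dx.
  apply: (@continuousM _ _ (fun x => ev x (cut * cut) * ev x g)
    (fun x => (K - ev x w)^-1)).
    by apply: continuousM; exact: cont.
  apply: (@continuousV _ _ (fun x => K - ev x w)); first by rewrite gt_eqF ?Kw.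
  by apply: continuousB; [exact: cst_continuous | exact: cont].
have B0 : [set x | 0 <= ev x cut] !=set0 by exists c; exact: ltW.
have [x0 /set_mem /= dx0 xmax] := EVT_max_rV B0 cB Phic.
have {}xmax x : 0 <= ev x cut -> Phi x <= Phi x0.
  by move=> ?; apply: xmax; exact/mem_set.
exists x0, (Phi x0).
have cc x : ev x (cut * cut) = ev x cut ^+ 2 by rewrite expr2.
have PE x : 0 <= ev x cut -> Phi x * (K - ev x w) = ev x (cut * cut) * ev x g.
  by move=> x1; rewrite /Phi divfK // gt_eqF // Kw.
have Pc : 0 < Phi c by rewrite /Phi divr_gt0 ?Kw ?(ltW cut_c) // cc mulr_gt0 // exprn_gt0.
have m0 : 0 < Phi x0 by apply: lt_le_trans Pc _; exact: xmax (ltW _).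
have prod0 : 0 < ev x0 (cut * cut) * ev x0 g by rewrite -PE // mulr_gt0 // Kw.
have gx0 : 0 < ev x0 g.
  by rewrite lt_def g0 andbT; apply: contraTneq prod0 => ->; rewrite mulr0 ltxx.
have cut0 : 0 < ev x0 cut.
  rewrite lt_def dx0 andbT; apply: contraTneq prod0 => E.
  by rewrite cc E expr0n mul0r ltxx.
split; first by split => //; rewrite PE.
  have : \forall y \near x0, 0 < ev y cut.
    exact: (@cvgr_gt R _ _ _ _ _ (cont cut x0) _ cut0).
  apply: filterS => y /ltW dy.
  suff H : ev y (cut * cut) * ev y g + Phi x0 * ev y w <=
      ev x0 (cut * cut) * ev x0 g + Phi x0 * ev x0 w by exact: H.
  have h := ler_wpM2r (ltW (Kw y dy)) (xmax y dy).
  rewrite -!PE //; move: h; rewrite !mulrBr.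
  move: (Phi y * _) (Phi y * _) (Phi x0 * _) (Phi x0 * _) (Phi x0 * _) => *; lra.
rewrite mulrC -(PE c (ltW cut_c)); apply: ler_wpM2r; first exact/ltW/Kw/ltW.
exact: xmax (ltW _).
Qed.
End WeightedMax.

Section Cutoff.
Variables (R : realType) (n : nat) (c : 'rV[R]_n) (rho : R).
Local Notation V := 'rV[R]_n.
Local Notation S := (smooth_fun R n).
Local Notation D := (smooth_der R n).
Variables (nu : 'cV[S]_(n + 1)) (T : 'rV[R]_(n + 1)).
Hypothesis nu_unit : ip nu nu = 1.
Hypothesis rho0 : 0 < rho.
Hypothesis T_le1 : \sum_a T 0 a ^+ 2 <= 1.
Local Notation Γ := (cdc D nu).
Local Notation L := (dlap D nu (sdir T)).

Definition displ (i : 'I_n) : S := scoord R i - scst n (c 0 i).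
(** Its square is the weight: then Γ(eta, eta) / eta stays bounded up to the boundary of the ball. *)
Definition cutoff : S := scst n (rho ^+ 2) - \sum_i displ i * displ i.
Definition dist2 (x : V) : R := \sum_i (x 0 i - c 0 i) ^+ 2.

Lemma ev_cutoff x : ev x cutoff = rho ^+ 2 - dist2 x.
Proof.
rewrite evD evN rmorph_sum; congr (_ - _); apply: eq_bigr => i _.
Qed.

Lemma sder_displ i j : D (lshift 1 j) (displ i) = (i == j)%:R.
Proof. by rewrite derB [X in X - _]sder_coord [X in _ - X]sder_cst subr0. Qed.

Lemma sder_cutoff j : D (lshift 1 j) cutoff = - (2 * displ j).
Proof.
rewrite derB [X in X - _]sder_cst sub0r der_sum; congr (- _).
rewrite (eq_bigr (fun i => 2 * (i == j)%:R * displ i)) => [|i _].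
  rewrite (bigD1 j) //= eqxx big1 ?addr0 ?mulr1 // => i /negPf ->.
  by rewrite mulr0 mul0r.
by rewrite derM sder_displ; ring.
Qed.

Lemma hess_cutoff a i : hess D cutoff a (lshift 1 i) = - (2 * (a == lshift 1 i)%:R).
Proof.
rewrite mxE sder_cutoff derN derM.
have -> : D a 2 = 0 by rewrite derD der1 addr0.
rewrite mul0r add0r; congr (- (2 * _)).
rewrite -(splitK a); case: (fintype.split a) => j; rewrite [unsplit _]/=.
  by rewrite sder_displ (inj_eq (@lshift_inj _ _)) eq_sym.
by rewrite [LHS]sder_r eq_rlshift.
Qed.

Lemma cutoff_cdc x : ev x (Γ cutoff cutoff) <= 4 * dist2 x.
Proof.
apply: le_trans (cdc_le nu x cutoff) _.
rewrite big_split_ord /= big_ord1 sder_r rmorph0 expr0n addr0.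
rewrite mulr_sumr; apply: ler_sum => i _; rewrite -[sder _ _]/(D _ _) sder_cutoff.
rewrite -[ev x _]/(- (2 * (x 0 i - c 0 i))).
by rewrite le_eqVlt; apply/orP; left; apply/eqP; ring.
Qed.

(** The trace of P costs 2 n, since its diagonal entries are at most 1; the drift costs 2 rho,
    since |T| <= 1. *)
Lemma cutoff_dlap x : dist2 x <= rho ^+ 2 ->
  - (2 * n%:R + 2 * rho) <= ev x (L cutoff).
Proof.
move=> dx; rewrite evD opprD; apply: lerD.
  rewrite /mxtrace rmorph_sum big_split_ord /= big_ord1.
  have -> : (tproj nu *m hess D cutoff) (rshift n ord0) (rshift n ord0) = 0.
    rewrite mxE big1 // => a _; have -> : hess D cutoff a (rshift n ord0) = 0.
      by rewrite mxE [D (rshift _ _) _]sder_r der0.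
    by rewrite mulr0.
  rewrite rmorph0 addr0.
  have E i : (tproj nu *m hess D cutoff) (lshift 1 i) (lshift 1 i) =
      - (2 * tproj nu (lshift 1 i) (lshift 1 i)).
    rewrite mxE (bigD1 (lshift 1 i)) //= big1 ?addr0 => [|a ai].
      by rewrite hess_cutoff eqxx mulr1 mulrN mulrC.
    by rewrite hess_cutoff (negPf ai) mulr0 oppr0 mulr0.
  under eq_bigr do rewrite E.
  rewrite -[X in - (2 * X%:R)](card_ord n) -sum1_card natr_sum mulr_sumr -sumrN.
  apply: ler_sum => i _; rewrite evN evM lerN2 mulr1 -[ev x 2]/(2 : R).
  by rewrite ler_piMr // tproj_diag_le1.
have -> : ev x (ip (sdir T) (grad D cutoff)) =
    - (2 * \sum_i T 0 (lshift 1 i) * (x 0 i - c 0 i)).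
  have -> : ip (sdir T) (grad D cutoff) =
      \sum_i scst n (T 0 (lshift 1 i)) * - (2 * displ i).
    rewrite ipE big_split_ord /= big_ord1.
    have -> : grad D cutoff (rshift n ord0) 0 = 0 by rewrite mxE [LHS]sder_r.
    rewrite mulr0 addr0; apply: eq_bigr => i _.
    by rewrite [sdir T _ _]mxE [grad _ _ _ _]mxE sder_cutoff.
  rewrite rmorph_sum mulr_sumr -sumrN; apply: eq_bigr => i _.
  rewrite -[LHS]/(T 0 (lshift 1 i) * - (2 * (x 0 i - c 0 i))).
  by ring.
rewrite lerN2 ler_pM2l //.
have TT : \sum_i T 0 (lshift 1 i) ^+ 2 <= 1.
  by move: T_le1; rewrite big_split_ord /= big_ord1 => ?; have := sqr_ge0 (T 0 (rshift n ord0)); lra.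
rewrite -(ler_pM2l (mulr_gt0 (ltr0Sn R 1) rho0)).
apply: (@le_trans _ _ (\sum_i (rho ^+ 2 * T 0 (lshift 1 i) ^+ 2 + (x 0 i - c 0 i) ^+ 2))).
  rewrite mulr_sumr; apply: ler_sum => i _.
  have := sqr_ge0 (rho * T 0 (lshift 1 i) - (x 0 i - c 0 i)); nra.
rewrite big_split /= -mulr_sumr -/(dist2 x).
have : rho ^+ 2 * (\sum_i T 0 (lshift 1 i) ^+ 2) <= rho ^+ 2.
  by rewrite ler_piMr // sqr_ge0.
nra.
Qed.

Lemma dist2_ge0 x : 0 <= dist2 x.
Proof. by apply: sumr_ge0 => i _; exact: sqr_ge0. Qed.

Lemma cdc_sqr f : Γ (f * f) (f * f) = 4 * (f * f) * Γ f f.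
Proof. by rewrite cdcMl !cdcMr; ring. Qed.

Lemma dlap_sqr f : L (f * f) = 2 * (f * L f + Γ f f).
Proof. by rewrite dlapM; ring. Qed.

Lemma ev_cdc_sqr x (f h : S) : ev x (4 * (f * f) * h) = 4 * ev x (f * f) * ev x h.
Proof. by []. Qed.
Lemma ev_dlap_sqr x (f h k : S) : ev x (2 * (f * h + k)) = 2 * (ev x f * ev x h + ev x k).
Proof. by []. Qed.

Lemma cutoff_sqr_bounds x : 0 < ev x cutoff ->
  - ev x (L (cutoff * cutoff)) <= 4 * n%:R * rho ^+ 2 + 4 * rho ^+ 3 /\
  ev x (Γ (cutoff * cutoff) (cutoff * cutoff)) / ev x (cutoff * cutoff)
    <= 16 * rho ^+ 2.
Proof.
move=> c0; have d0 := dist2_ge0 x.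
have dr : dist2 x <= rho ^+ 2 by have := ev_cutoff x; lra.
have cr : ev x cutoff <= rho ^+ 2 by have := ev_cutoff x; lra.
have cc := cutoff_cdc x; have lc := cutoff_dlap dr.
have c2 : 0 < ev x (cutoff * cutoff) by rewrite evM mulr_gt0.
split.
  rewrite dlap_sqr ev_dlap_sqr; have := cdc_ge0 nu_unit x cutoff.
  move: c0 cr lc; move: (ev x cutoff) (ev x (L cutoff)) (ev x (Γ _ _)) => a l b a0 ar la b0.
  have N : 0 <= 2 * n%:R + 2 * rho by rewrite addr_ge0 // mulr_ge0 // ltW.
  have : a * - l <= rho ^+ 2 * (2 * n%:R + 2 * rho).
    have la' : - l <= 2 * n%:R + 2 * rho by lra.
    apply: le_trans (ler_wpM2l (ltW a0) la') _.
    by rewrite ler_wpM2r.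
  rewrite (_ : rho ^+ 2 * _ = 2 * n%:R * rho ^+ 2 + 2 * rho ^+ 3); last by ring.
  lra.
rewrite cdc_sqr ev_cdc_sqr mulrAC mulfK ?gt_eqF //.
lra.
Qed.

End Cutoff.

Lemma half_bound (R : realType) (m l a x y K r : R) :
  - l <= 4 * x * r ^+ 2 + 4 * y -> 7 * K * a <= 7 * K * (16 * r ^+ 2) ->
  2 * m <= - l + 7 * K * a -> m <= 2 * x * r ^+ 2 + 2 * y + 56 * K * r ^+ 2.
Proof. by lra. Qed.

Section Interior.
Variables (R : realType) (n : nat) (u : 'rV[R]_n -> R) (T : 'rV[R]_(n + 1)).
Hypothesis u_smooth : smooth u.
Hypothesis tr_u : translator u T.
Hypothesis T_le1 : \sum_a T 0 a ^+ 2 <= 1.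
Local Notation V := 'rV[R]_n.
Local Notation S := (smooth_fun R n).
Local Notation D := (smooth_der R n).
Local Notation nu := (snormal u_smooth).
Local Notation W := (sarea u_smooth).
Local Notation Q := (normA2 D nu).
Variables (c : V) (rho K : R).
Hypothesis rho0 : 0 < rho.

Lemma normA2_ge0 x : 0 <= ev x Q.
Proof.
rewrite (normA2E (snormal_unit u_smooth) (dnu_snormal u_smooth) (curl_snormal u_smooth)).
by rewrite rmorph_sum; apply: sumr_ge0 => b _; exact: (cdc_ge0 (snormal_unit u_smooth)).
Qed.

Lemma ball_compact : compact [set x : V | dist2 c x <= rho ^+ 2].
Proof.
apply: bounded_closed_compact.
  exists (`|c| + rho); split; first exact: num_real.
  move=> M cM x /= dx; apply: le_trans (ltW cM).
  rewrite -[x](subrK c) addrC; apply: le_trans (ler_normD _ _) _.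
  rewrite lerD2l [leLHS]mx_normrE; apply: bigmax_le; first exact: ltW.
  move=> [i j] _ /=; rewrite ord1 !mxE.
  rewrite -(@ler_pXn2r _ 2) ?nnegrE ?(ltW rho0) // real_normK ?num_real //.
  apply: le_trans dx; rewrite /dist2 (bigD1 j) //= lerDl.
  by apply: sumr_ge0 => k _; exact: sqr_ge0.
have -> : [set x : V | dist2 c x <= rho ^+ 2] = cutoff c rho @^-1` [set y | 0 <= y].
  have E x : cutoff c rho x = rho ^+ 2 - dist2 c x := ev_cutoff c rho x.
  by apply/funext => x; rewrite /preimage /mkset E subr_ge0.
apply: closed_comp; last exact: closed_ge.
by move=> x _; apply: smooth_continuous; exact: smooth_funP.
Qed.

(** The value of eta g / (K - w) at c, where eta = rho^4, is at most its maximum.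
    Dividing by rho^4 bounds g(c) by a multiple of K / rho + (K / rho)^2, up to lower order terms. *)
Lemma interior_estimate :
  (forall x, dist2 c x <= rho ^+ 2 -> 2 * ev x (W * W) <= K) ->
  ev c (W * W * Q) * rho ^+ 4 <=
    K * (2 * n%:R * rho ^+ 2 + 2 * rho ^+ 3 + 56 * K * rho ^+ 2).
Proof.
move=> wK.
have dc : dist2 c c = 0 by rewrite /dist2 big1 // => i _; rewrite subrr expr0n.
have w1 x : 1 <= ev x (W * W) by rewrite evM mulr_ege1 // area_ge1.
have g0 x : 0 <= ev x (W * W * Q).
  by rewrite evM; apply: mulr_ge0; [exact: le_trans ler01 (w1 x) | exact: normA2_ge0].
have cK : 2 * ev c (W * W) <= K by apply: wK; rewrite dc sqr_ge0.
have K0 : 0 < K by move: (w1 c) cK; move: (ev c _) => a a1 aK; lra.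
have RHS0 : 0 <= K * (2 * n%:R * rho ^+ 2 + 2 * rho ^+ 3 + 56 * K * rho ^+ 2).
  by rewrite mulr_ge0 ?addr_ge0 ?mulr_ge0 ?exprn_ge0 ?ler0n ?ltW.
have [gc0|gc0] := leP (ev c (W * W * Q)) 0.
  have -> : ev c (W * W * Q) = 0 by apply/le_anti; rewrite gc0 g0.
  by rewrite mul0r.
have cutc : ev c (cutoff c rho) = rho ^+ 2 by rewrite ev_cutoff dc subr0.
have BE x : (0 <= ev x (cutoff c rho)) = (dist2 c x <= rho ^+ 2).
  by rewrite ev_cutoff subr_ge0.
have cB : compact [set x | 0 <= ev x (cutoff c rho)].
  have -> : [set x | 0 <= ev x (cutoff c rho)] = [set x | dist2 c x <= rho ^+ 2].
    by apply/funext => x; rewrite /mkset BE.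
  exact: ball_compact.
have wB x : 0 <= ev x (cutoff c rho) -> ev x (W * W) < K.
  by rewrite BE => /wK; move: (w1 x); move: (ev x (W * W)) => a a1 aK; lra.
have c0 : 0 < ev c (cutoff c rho) by rewrite cutc exprn_gt0.
have [x0 [m [[m0 cut0 gx0 mE] Fmax mc]]] := weighted_max cB c0 gc0 g0 wB.
have dx0 : dist2 c x0 <= rho ^+ 2 by rewrite -BE ltW.
have [q q0 Lg] := ev_dlap_g u_smooth tr_u x0.
have e0 : 0 < ev x0 (cutoff c rho * cutoff c rho) by rewrite evM mulr_gt0.
have b3 := max_point_bound (snormal_unit u_smooth) (sareaVK u_smooth)
  (area_ge1 u_smooth x0) q0 Lg (ev_dlap_w u_smooth tr_u x0) Fmax m0 e0 gx0 (wK _ dx0) mE.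
have [b1 b2] := cutoff_sqr_bounds (snormal_unit u_smooth) rho0 T_le1 cut0.
rewrite -mulrA in b3.
have b4 := ler_wpM2l (mulr_ge0 (ler0n R 7) (ltW K0)) b2.
have b5 : m <= 2 * n%:R * rho ^+ 2 + 2 * rho ^+ 3 + 56 * K * rho ^+ 2.
  exact: half_bound b1 b4 b3.
apply: le_trans (ler_wpM2l (ltW K0) b5).
have cc : ev c (cutoff c rho * cutoff c rho) = rho ^+ 4 by rewrite evM cutc -exprD.
rewrite cc in mc; apply: le_trans mc _.
rewrite mulrC; apply: ler_wpM2r; first exact: ltW.
by rewrite gerBl (le_trans ler01 (w1 c)).
Qed.
End Interior.

(** * The growth condition makes the curvature vanish *)

Lemma le0_of_bounded_multiples (R : realType) (a C r0 : R) :
  (forall r, r0 <= r -> a * r <= C) -> a <= 0.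
Proof.
move=> H; rewrite leNgt; apply/negP => a0.
have := H (Num.max r0 ((`|C| + 1) / a)); rewrite le_max lexx => /(_ isT).
apply/negP; rewrite -ltNge; apply: (@lt_le_trans _ _ (`|C| + 1)).
  by rewrite ltr_pwDr // ler_norm.
by rewrite mulrC -ler_pdivrMr // le_max lexx orbT.
Qed.

Section Growth.
Variables (R : realType) (n : nat) (u : 'rV[R]_n -> R).
Hypothesis u_smooth : smooth u.
Local Notation V := 'rV[R]_n.
Local Notation W := (sarea u_smooth).
Hypothesis growth : (fun x : 'rV[R]_n => enorm (gradient u x))
                =o_at_infinity (fun x : 'rV[R]_n => enorm x `^ (1 / 4)).

Lemma enorm_ge0 k (x : 'rV[R]_k) : 0 <= enorm x.
Proof. exact: sqrtr_ge0. Qed.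

Lemma enorm_sq k (x : 'rV[R]_k) : enorm x ^+ 2 = \sum_i x 0 i ^+ 2.
Proof.
rewrite sqr_sqrtr; first by apply: eq_bigr => i _; rewrite expr2.
by apply: sumr_ge0 => i _; rewrite -expr2 sqr_ge0.
Qed.

(** Far out this is the square of the growth condition; the rest is compact. *)
Lemma area_growth : exists C, forall x, ev x (W * W) <= C + Num.sqrt (enorm x).
Proof.
have /eqoP/(_ 1 ltr01)[M _ MP] := growth.
have cW : {within [set x : V | dist2 0 x <= (Num.max M 1) ^+ 2],
    continuous (fun x => ev x (W * W))}.
  apply: continuous_subspaceT; apply: smooth_continuous; exact: smooth_funP (W * W).
have M0 : 0 < Num.max M 1 by rewrite lt_max ltr01 orbT.
have B0 : [set x : V | dist2 0 x <= (Num.max M 1) ^+ 2] !=set0.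
  by exists 0; rewrite /= /dist2 big1 ?sqr_ge0 // => i _; rewrite subrr expr0n.
have [x0 _ xmax] := EVT_max_rV B0 (@ball_compact R n 0 _ M0) cW.
have WE x : ev x (W * W) = 1 + enorm (gradient u x) ^+ 2.
  rewrite enorm_sq; transitivity (area_factor u x ^+ 2); first by rewrite expr2.
  by rewrite area_sq; congr (_ + _); apply: eq_bigr => i _; rewrite mxE.
have w0 : 1 <= ev x0 (W * W) by rewrite WE lerDl sqr_ge0.
exists (ev x0 (W * W)) => x; have [xM|xM] := leP (enorm x) (Num.max M 1).
  apply: ler_wpDr; first exact: sqrtr_ge0.
  apply: xmax; apply/mem_set => /=.
  have -> : dist2 0 x = enorm x ^+ 2.
    by rewrite enorm_sq; apply: eq_bigr => i _; rewrite mxE subr0.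
  by rewrite ler_pXn2r // nnegrE ?enorm_ge0 // ltW.
have Mx : M < enorm x by apply: le_lt_trans xM; rewrite le_max lexx.
have h : enorm (gradient u x) <= enorm x `^ (1 / 4).
  have := MP x Mx; rewrite /= mul1r ger0_norm ?enorm_ge0 //.
  by rewrite ger0_norm // powR_ge0.
rewrite WE; apply: lerD => //.
apply: (@le_trans _ _ ((enorm x `^ (1 / 4)) ^+ 2)).
  by rewrite ler_pXn2r // nnegrE ?enorm_ge0 ?powR_ge0.
rewrite -powR_mulrn ?powR_ge0 // -powRrM -powR12_sqrt ?enorm_ge0 //.
by rewrite (_ : 1 / 4 * 2%:R = 2^-1 :> R) //; field.
Qed.

(** On the ball of radius r^2 around c the square of W is at most 3 r once r is large. So the interior
    estimate applies with K = 6 r, and it bounds g(c) r independently of r. *)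
Lemma growth_normA2 (T : 'rV[R]_(n + 1)) (c : V) : translator u T -> \sum_a T 0 a ^+ 2 <= 1 ->
  ev c (W * W * normA2 (smooth_der R n) (snormal u_smooth)) <= 0.
Proof.
move=> tr_u T1; have [C CP] := area_growth.
set a := ev c _.
(* the coefficients of the interior estimate for the radius r^2 and K = 6 r: the powers of r are at
   most r^6, and 338 = 2 + 56 * 6 *)
apply: (@le0_of_bounded_multiples _ _ (6 * (2 * n%:R + 338)) (1 + enorm c + `|C|)) => r rP.
have r1 : 1 <= r by have := enorm_ge0 c; have := normr_ge0 C; lra.
have rc : enorm c <= r by have := normr_ge0 C; lra.
have rC : C <= r by have := enorm_ge0 c; have := ler_norm C; lra.
have r0 : 0 < r by lra.
have wK x : dist2 c x <= (r ^+ 2) ^+ 2 -> 2 * ev x (W * W) <= 6 * r.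
  move=> dx; suff y : Num.sqrt (enorm x) <= 2 * r.
    by have := CP x; move: (ev x _) => b h; lra.
  set y := Num.sqrt _.
  have y4 : (y ^+ 2) ^+ 2 = enorm x ^+ 2 by rewrite sqr_sqrtr // enorm_ge0.
  have y0 : 0 <= y by exact: sqrtr_ge0.
  have xx : enorm x ^+ 2 <= 2 * dist2 c x + 2 * enorm c ^+ 2.
    rewrite !enorm_sq /dist2 !mulr_sumr -big_split; apply: ler_sum => i _ /=.
    (* 2 (x - c)^2 + 2 c^2 - x^2 is the square of x - 2 c *)
    have := sqr_ge0 (x 0 i - 2 * c 0 i); lra.
  have cr : enorm c ^+ 2 <= r ^+ 4.
    apply: (@le_trans _ _ (r ^+ 2)); first by rewrite ler_pXn2r // nnegrE ?enorm_ge0 // ltW.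
    by apply: ler_weXn2l.
  rewrite -(@ler_pXn2r _ 4) ?nnegrE ?(mulr_ge0 _ (ltW r0)) //.
  rewrite (_ : y ^+ 4 = (y ^+ 2) ^+ 2); last by rewrite -exprM.
  rewrite y4 exprMn; have {}dx : dist2 c x <= r ^+ 4 by rewrite (exprM r 2 2).
  have : 0 <= r ^+ 4 by rewrite exprn_ge0 // ltW.
  move: cr dx xx; move: (r ^+ 4) (dist2 _ _) (enorm _ ^+ _) (enorm _ ^+ _) => *. lra.
have := interior_estimate tr_u T1 (exprn_gt0 2 r0) wK; rewrite -/a.
have r7 : 0 < r ^+ 7 by rewrite exprn_gt0.
have e1 : (r ^+ 2) ^+ 4 = r * r ^+ 7 by rewrite -exprM -exprS.
have e2 : (2 * n%:R * (r ^+ 2) ^+ 2 + 2 * (r ^+ 2) ^+ 3 + 56 * (6 * r) * (r ^+ 2) ^+ 2)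
   <= (2 * n%:R + 338) * r ^+ 6.
  have q1 : r ^+ 4 <= r ^+ 6 by apply: ler_weXn2l.
  have q2 : r ^+ 5 <= r ^+ 6 by apply: ler_weXn2l.
  have n0 : (0 : R) <= n%:R by [].
  have q3 := ler_wpM2l n0 q1.
  rewrite (_ : 2 * n%:R * _ + _ + _ =
    2 * (n%:R * r ^+ 4) + 2 * r ^+ 6 + 336 * r ^+ 5); last by ring.
  rewrite (_ : (2 * n%:R + 338) * r ^+ 6 = 2 * (n%:R * r ^+ 6) + 338 * r ^+ 6); last by ring.
  by lra.
have e3 := ler_wpM2l (mulr_ge0 (ler0n R 6) (ltW r0)) e2.
move=> h; have {h}h := le_trans h e3.
rewrite -(ler_pM2r r7) -mulrA -e1; apply: le_trans h _.
by rewrite le_eqVlt; apply/orP; left; apply/eqP; ring.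
Qed.
End Growth.

(** * Flat graphs are hyperplanes *)

Section Rigidity.
Variables (R : realType) (n : nat).
Local Notation V := 'rV[R]_n.
Local Notation D := (smooth_der R n).

Lemma smooth_const (f : V -> R) : smooth f -> (forall i x, partial i f x = 0) ->
  forall x, f x = f 0.
Proof.
move=> sf f0 x.
have [t _] := MVT_line 0 1 (fun y => smooth_is_derive_dir y x sf).
rewrite scale1r addr0 big1 ?mulr0 => [|i _]; last by rewrite f0 mulr0.
by move/eqP; rewrite subr_eq0 => /eqP.
Qed.

Lemma affine_of_const_partials (f : V -> R) (p : 'I_n -> R) : smooth f ->
  (forall i x, partial i f x = p i) -> forall x, f x = f 0 + \sum_i x 0 i * p i.
Proof.
move=> sf fp x.
have [t _] := MVT_line 0 1 (fun y => smooth_is_derive_dir y x sf).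
rewrite scale1r addr0 mul1r => /eqP; rewrite subr_eq addrC => /eqP ->.
by congr (_ + _); apply: eq_bigr => i _; rewrite fp.
Qed.

(** A gradient without tangential part is a multiple of nu, and the factor vanishes because
    the vertical component of the gradient is 0 while that of nu is not. *)
Lemma cdc_eq0_grad (nu : 'cV[smooth_fun R n]_(n + 1)) (x : V) (f : smooth_fun R n) :
  ip nu nu = 1 -> ev x (nu (rshift n 0) 0) != 0 ->
  ev x (cdc D nu f f) = 0 -> forall a, ev x (D a f) = 0.
Proof.
move=> nu1 nu0; rewrite (cdc_sq D nu1) ev_ip_sq => /eqP.
rewrite psumr_eq0 => [/allP P0|a _]; last exact: sqr_ge0.
pose b := ev x (ip nu (grad D f)).
have E a : ev x (D a f) = b * ev x (nu a 0).
  have := P0 a (mem_index_enum a); rewrite sqrf_eq0 tprojE => /eqP.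
  have entry (v w : 'cV[smooth_fun R n]_(n + 1)) k : (v - k *: w) a 0 = v a 0 - k * w a 0.
    by rewrite !mxE.
  by rewrite entry [grad _ _ _ _]mxE evD evN evM => /eqP; rewrite subr_eq0 => /eqP.
have b0 : b = 0.
  have := E (rshift n 0); rewrite [D _ _]sder_r rmorph0 => /esym/eqP.
  by rewrite mulf_eq0 (negPf nu0) orbF => /eqP.
by move=> a; rewrite E b0 mul0r.
Qed.

(** |A| = 0 makes nu constant, and Du consists of quotients of components of nu. *)
Lemma gradient_const (u : V -> R) (u_smooth : smooth u) :
  (forall x, ev x (normA2 D (snormal u_smooth)) = 0) ->
  forall i x, partial i u x = partial i u 0.
Proof.
move=> Q0 i x; have nu1 := snormal_unit u_smooth.
have N0 := dnu_snormal u_smooth.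
have s0 y : ev y (sareaV u_smooth) != 0 by rewrite invr_neq0 // gt_eqF // area_gt0.
have dnu0 a b y : ev y (D a (snormal u_smooth b 0)) = 0.
  apply: (cdc_eq0_grad nu1); first by rewrite snormal_r.
  have := Q0 y; rewrite (normA2E nu1 N0 (curl_snormal u_smooth)) rmorph_sum => /eqP.
  rewrite psumr_eq0 => [/allP/(_ b (mem_index_enum b))/eqP // | c _].
  exact: cdc_ge0.
have cst_nu b y : ev y (snormal u_smooth b 0) = ev 0 (snormal u_smooth b 0).
  apply: (smooth_const (smooth_funP (snormal u_smooth b 0))) => j z.
  by have := dnu0 (lshift 1 j) b z; rewrite [D _ _]sder_l.
have sc y : ev y (sareaV u_smooth) = ev 0 (sareaV u_smooth).
  by have := cst_nu (rshift n 0) y; rewrite snormal_r.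
have := cst_nu (lshift 1 i) x; rewrite snormal_l !evN !evM sc => /oppr_inj.
exact: mulIf.
Qed.

Lemma affine_graph_hyperplane (u : V -> R) (p : 'I_n -> R) :
  (forall x, u x = u 0 + \sum_i x 0 i * p i) -> hyperplane (graph u).
Proof.
move=> up.
pose a : 'rV[R]_(n + 1) := row_mx (\row_i (- p i)) 1%:M.
have dotE x (t : R) : dot a (row_mx x t%:M) = t - \sum_i x 0 i * p i.
  rewrite /dot big_split_ord /= big_ord1 !row_mxEr !mxE eqxx mul1r addrC.
  congr (_ + _); rewrite -sumrN; apply: eq_bigr => i _.
  by rewrite !row_mxEl mxE mulNr mulrC.
exists a, (u 0); split.
  apply/eqP => a0; have := congr1 (fun m : 'rV_(n + 1) => m 0 (rshift n 0)) a0.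
  by rewrite /a row_mxEr !mxE eqxx => /eqP; rewrite oner_eq0.
apply/seteqP; split => [q [x _ <-]|q] /=.
  by rewrite dotE up addrK.
have qE : q = row_mx (lsubmx q) (rsubmx q 0 0)%:M.
  by rewrite -mx11_scalar hsubmxK.
rewrite qE dotE => h; exists (lsubmx q) => //.
by rewrite up -h subrK.
Qed.
End Rigidity.


Theorem theorem1p4 (R : realType) (n : nat) (u : 'rV[R]_n -> R)
    (T : 'rV[R]_(n + 1))
    (u_smooth : smooth u)
    (T_unit : enorm T = 1)
    (T_not_parallel : ~ exists c : R, T = c *: e_last)
    (u_translator : translator u T)
    (growth : (fun x : 'rV[R]_n => enorm (gradient u x))
                =o_at_infinity (fun x : 'rV[R]_n => enorm x `^ (1 / 4))) :
  hyperplane (graph u).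
Proof.
have T1 : \sum_a T 0 a ^+ 2 <= 1 by rewrite -enorm_sq T_unit expr1n.
apply: (@affine_graph_hyperplane _ _ _ (fun i => partial i u 0)).
apply: affine_of_const_partials => //; apply: (gradient_const (u_smooth := u_smooth)) => x.
have := growth_normA2 u_smooth growth x u_translator T1.
have w1 : 0 < ev x (sarea u_smooth * sarea u_smooth).
  by rewrite evM mulr_gt0 // area_gt0.
rewrite evM pmulr_rle0 // => Q0; apply/le_anti; rewrite Q0.
exact: normA2_ge0.
Qed.
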